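(* Let $0<\alpha<1$. (i) Let $0<\kappa<2$ and $m\in\mathbb{Z}$. There is a constant $C_{m,\kappa,\alpha}$ such that for all $\phi\in\Lambda^\alpha_{(m,\kappa)}$, $$\|I(\phi)\|_{\Lambda^\alpha_{(m,\kappa)}}\le C_{m,\kappa,\alpha}\,\|\phi\|_{\Lambda^\alpha_{(m,\kappa)}}.$$ (ii) (Case $\kappa=0$.) For every integer $m\ge 0$ there is a constant $C_{m,\alpha}$ such that for all $\phi\in\Lambda^\alpha_{(m,0)}$, $$\|I(\phi)\|_{\Lambda^\alpha_{(m+1,0)}}\le C_{m,\alpha}\,\|\phi\|_{\Lambda^\alpha_{(m,0)}},$$ and, for $m=-1$, there is a constant $C_\alpha$ such that for all $\phi\in\Lambda^\alpha_{(-1,0)}$, $$\|I(\phi)\|_{\Lambda^\alpha_{(\log,0)}}\le C_\alpha\,\|\phi\|_{\Lambda^\alpha_{(-1,0)}}.$$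
   Context: For $\kappa\in\mathbb{R}$, $m\in\mathbb{Z}$, $0<\alpha<1$, $\Lambda^\alpha_{(m,\kappa)}$ is the space of functions $\phi$ on $\mathbb{R}$ for which there is a constant $C$ such that for all $x,y\in\mathbb{R}$ $$|\phi(x)|\le C(1+|x|)^m e^{\kappa|x|},\qquad |\phi(x)-\phi(y)|\le C|x-y|^\alpha\{(1+|x|)^m e^{\kappa|x|}+(1+|y|)^m e^{\kappa|y|}\};$$ $\|\phi\|_{\Lambda^\alpha_{(m,\kappa)}}$ is the infimum of such constants $C$. The space $\Lambda^\alpha_{(\log,\kappa)}$ and its norm are defined in the same way with the weight $(1+|x|)^m$ replaced by $\log(2+|x|)$. The operator $I$ is $$I(\phi)(y)=(e^{-y}+e^{y})\,H\!\left(\frac{\phi(\cdot)}{e^{-(\cdot)}+e^{(\cdot)}}\right)(y),$$ where $H$ is the principal value operator $$(H\psi)(y)=\lim_{\epsilon\to0^+}\int_{|y-\eta|>\epsilon}\frac{1}{e^{y-\eta}-e^{-(y-\eta)}}\,\psi(\eta)\,d\eta .$$ *)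

(* Defs.v *)
From mathcomp Require Export all_boot all_order all_algebra.
From mathcomp Require Export all_classical all_reals all_analysis.
From mathcomp Require Export complex.

Set Implicit Arguments.
Unset Strict Implicit.
Unset Printing Implicit Defensive.

Export Order.TTheory GRing.Theory Num.Theory.
Export numFieldNormedType.Exports.

Local Open Scope classical_set_scope.
Local Open Scope ring_scope.
Local Open Scope complex_scope.

(* Functions on the real line are complex-valued; the real-valued case is
   that of functions with zero imaginary part. *)

Section WeightedHolder.
Variable R : realType.

Definition pow_weight (m : int) (kappa : R) (x : R) : R :=
  (1 + `|x|) ^ m * expR (kappa * `|x|).

Definition log_weight (kappa : R) (x : R) : R :=
  ln (2 + `|x|) * expR (kappa * `|x|).

Definition holder_bound (alpha : R) (w : R -> R) (phi : R -> R[i]) (C : R) :=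
  (forall x, ComplexField.Normc.normc (phi x) <= C * w x) /\
  (forall x y, ComplexField.Normc.normc (phi x - phi y) <=
     C * `|x - y| `^ alpha * (w x + w y)).

Definition Lambda (alpha : R) (w : R -> R) : set (R -> R[i]) :=
  [set phi | exists C, holder_bound alpha w phi C].

(* The infimum is taken in the extended reals, so that it is +oo outside of
   [Lambda alpha w]. *)
Definition Lambda_norm (alpha : R) (w : R -> R) (phi : R -> R[i]) : \bar R :=
  ereal_inf [set C%:E | C in holder_bound alpha w phi].

End WeightedHolder.

Section PrincipalValue.
Variable R : realType.
Local Notation mu := (@lebesgue_measure R).

Definition cintegrable (D : set R) (f : R -> R[i]) : Prop :=
  mu.-integrable D (fun x => (complex.Re (f x))%:E) /\
  mu.-integrable D (fun x => (complex.Im (f x))%:E).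

Definition cintegral (D : set R) (f : R -> R[i]) : R[i] :=
  (\int[mu]_(x in D) complex.Re (f x)) +i*
  (\int[mu]_(x in D) complex.Im (f x)).

Definition H_integrand (psi : R -> R[i]) (y eta : R) : R[i] :=
  (1 / (expR (y - eta) - expR (- (y - eta))))%:C * psi eta.

Definition H_domain (y eps : R) : set R := [set eta | eps < `|y - eta|].

(* [R[i]^o] is [R[i]] with the topology of its modulus. *)
Definition H_truncated (psi : R -> R[i]) (y eps : R) : R[i]^o :=
  cintegral (H_domain y eps) (H_integrand psi y).

Definition H (psi : R -> R[i]) (y : R) : R[i] :=
  lim (H_truncated psi y eps @[eps --> 0^'+]).

(* [\int] and [lim] are total: this says that [H psi y] has no default
   value in it. *)
Definition H_defined (psi : R -> R[i]) (y : R) : Prop :=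
  (forall eps, 0 < eps -> cintegrable (H_domain y eps) (H_integrand psi y)) /\
  cvg (H_truncated psi y eps @[eps --> 0^'+]).

Definition I_density (phi : R -> R[i]) (eta : R) : R[i] :=
  phi eta / (expR (- eta) + expR eta)%:C.

Definition I_op (phi : R -> R[i]) (y : R) : R[i] :=
  (expR (- y) + expR y)%:C * H (I_density phi) y.

Definition I_defined (phi : R -> R[i]) : Prop :=
  forall y, H_defined (I_density phi) y.

End PrincipalValue.

(* [I_op] is well defined and bounded by [C] from [Lambda alpha w] to
   [Lambda alpha w']. *)
Definition I_bounded (R : realType) (alpha : R) (w w' : R -> R) (C : R) :
    Prop :=
  forall phi, Lambda alpha w phi ->
    [/\ I_defined phi,
        Lambda alpha w' (I_op phi) &
        (Lambda_norm alpha w' (I_op phi) <=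
           C%:E * Lambda_norm alpha w phi)%E].

(* Main.v *)
(** Since cosh y = cosh (y - eta) cosh eta + sinh (y - eta) sinh eta, the kernel
    of I is (coth t + tanh eta) / 2 with t = y - eta, and coth t = tanh t + 2 / sinh (2 t)
    turns it into
      1 / sinh (2 t) + (tanh t + tanh eta) / 2.
    The second term equals sinh y / (2 cosh t cosh eta): it is bounded by
    exp (|y| - |t| - |eta|), which is of order 1 for eta between 0 and y and decays
    exponentially elsewhere, so it sends w to w + int_0^|y| w (this is the gain of one
    power, or of a logarithm, when kappa = 0); its increment in y is
    O(d exp (- 2 |t|)).  The first term is odd, so its truncations have mean zero;
    subtracting the same constant f y at both points, the truncations at distance
    2 d differ by O(d^alpha) at two points d apart, and the part within distance eps
    of the singularity contributes O(eps^alpha).  The weight enters only through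
    w eta <= A exp (rho |y - eta|) w y with rho < 2. *)

From mathcomp Require Import ring lra measurable_realfun.
Require Import Defs.

Set Implicit Arguments.
Unset Strict Implicit.
Unset Printing Implicit Defensive.

Local Open Scope classical_set_scope.
Local Open Scope ring_scope.

(** * The kernel *)

(** The piece coth t is odd and carries the singularity, but its truncations are not integrable over
    the line, so mean zero could not be used there to subtract a constant from f. The odd function 1
    / sinh (2 t) has the same singularity as coth t / 2 and decays at rate 2, which also pays for a
    weight growing at rate rho < 2.

    For two points at distance d the truncation radius is 2 d rather than d. Then both truncated
    kernels vanish for |t| <= d, and near the singularity their difference is O(d / |t|^2) even on
    the shell where only one of them is cut off. Multiplied by |f eta - f y| = O(|t|^alpha) this
    integrates to O(d^alpha), because alpha < 1.

    None of these estimates loses anything in the weight; only the size of the smooth part can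
    exceed w. The argument is therefore run once for an abstract pair [w], [w'], and the distinction
    between the values of kappa and m reduces to one scalar integral of w. *)

Section Kernels.
Variable R : realType.
Implicit Types s t x y eta d a b : R.

(* half_csch t = 1 / (2 sinh t), sing_kernel t = 1 / sinh (2 t) and
   reg_kernel y eta = (tanh (y - eta) + tanh eta) / 2; the first two are 0 at t = 0. *)
Definition half_csch t : R := (expR t - expR (- t))^-1.

Definition sing_kernel t : R := 2 * half_csch (2 * t).

Definition reg_kernel y eta : R :=
  (expR y - expR (- y)) /
  ((expR (y - eta) + expR (- (y - eta))) * (expR eta + expR (- eta))).

Lemma expR_gap_neq0 t : t != 0 -> expR t - expR (- t) != 0.
Proof.
move=> t0; rewrite subr_eq0; apply/eqP => /expR_inj h; move: t0; rewrite -subr_eq0.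
by move/eqP; apply; lra.
Qed.

Lemma sym_expR_gt0 t : 0 < expR t + expR (- t).
Proof. by rewrite addr_gt0 ?expR_gt0. Qed.

Lemma sym_expR_ge0 t : 0 <= expR t + expR (- t).
Proof. exact: ltW (sym_expR_gt0 t). Qed.

Lemma sym_expR_ge t : expR `|t| <= expR t + expR (- t).
Proof.
by have := expR_ge0 t; have := expR_ge0 (- t); case: (ger0P t) => _; lra.
Qed.

Lemma sym_expRV_le t : (expR t + expR (- t))^-1 <= expR (- `|t|).
Proof.
by rewrite [leRHS]expRN lef_pV2 ?posrE ?expR_gt0 ?sym_expR_gt0 ?sym_expR_ge.
Qed.

Lemma abs_expR_gap t : `|expR t - expR (- t)| = expR `|t| - expR (- `|t|).
Proof.
have [t0|t0] := ger0P t.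
  by rewrite ger0_norm // subr_ge0 ler_expR; lra.
by rewrite ltr0_norm ?subr_lt0 ?ltr_expR ?opprB ?opprK //; lra.
Qed.

Lemma abs_expR_gap_le t : `|expR t - expR (- t)| <= expR `|t|.
Proof. by rewrite abs_expR_gap gerBl expR_ge0. Qed.

(** The inequality 1 + u <= exp u at u = -d bounds exp (- d) from below; inverted, it gives exp d <=
    1 / (1 - d) <= 1 + 2 d on [0, 1/2]. *)
Lemma expR_gap_small d : `|d| <= 2^-1 -> `|expR d - expR (- d)| <= 3 * `|d|.
Proof.
rewrite abs_expR_gap; move: `|d| (normr_ge0 d) => {}d d0 d1.
have h1 := expR_ge1Dx (- d).
have h2 : expR d <= (1 - d)^-1.
  by rewrite -[leLHS]invrK -expRN lef_pV2 ?posrE ?expR_gt0 //; lra.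
have h3 : (1 - d)^-1 <= 1 + 2 * d.
  by rewrite -[leLHS]mul1r ler_pdivrMr; nra.
lra.
Qed.

Lemma expR_half_le2 : expR (2^-1 : R) <= 2.
Proof.
have h1 := expR_ge1Dx (- 2^-1 : R).
by rewrite -[expR _]invrK -expRN -[leRHS]invrK lef_pV2 // ?posrE ?expR_gt0 //; lra.
Qed.

(** One bound for both regimes, 1 / |t| near 0 and exp (- |t|) far away. Cleared of denominators it
    reads 1 + |t| <= exp (2 |t|). *)
Lemma half_csch_le t : t != 0 -> `|half_csch t| <= expR (- `|t|) * (1 + `|t|^-1).
Proof.
move=> t0; rewrite /half_csch normfV abs_expR_gap.
have {t0}: 0 < `|t| by rewrite normr_gt0.
move: `|t| => {}t t0.
have E0 := expR_gt0 t.
have hE : 1 + t + t <= expR t * expR t.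
  by rewrite -expRD; apply: le_trans (expR_ge1Dx _); rewrite addrA.
rewrite expRN; move: (expR t) E0 hE => E E0 hE.
have D0 : 0 < E - E^-1.
  rewrite -(pmulr_rgt0 _ E0) mulrBr divff ?gt_eqF //; lra.
rewrite -[leLHS]mul1r ler_pdivrMr //.
have -> : E^-1 * (1 + t^-1) * (E - E^-1) =
  1 + (E * E - 1 - t) / (t * (E * E)).
  by field; rewrite !gt_eqF.
by rewrite lerDl divr_ge0 ?mulr_ge0 //; lra.
Qed.

Lemma half_cschN t : half_csch (- t) = - half_csch t.
Proof. by rewrite /half_csch opprK -invrN opprB. Qed.

Lemma sing_kernelN t : sing_kernel (- t) = - sing_kernel t.
Proof. by rewrite /sing_kernel mulrN half_cschN mulrN. Qed.

Lemma sing_kernel_le t : t != 0 ->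
  `|sing_kernel t| <= 2 * (expR (- 2 * `|t|) * (1 + `|t|^-1)).
Proof.
move=> t0; rewrite normrM ger0_norm // ler_wpM2l //.
have n0 : 0 < `|t| by rewrite normr_gt0.
apply: le_trans (half_csch_le _) _; first by rewrite mulf_neq0 // ?pnatr_eq0.
rewrite normrM ger0_norm // mulNr ler_wpM2l ?expR_ge0 // lerD2l.
rewrite lef_pV2 ?posrE ?mulr_gt0 //; lra.
Qed.

(* 1 / sinh (2 t) = (coth t - tanh t) / 2, so differences are governed by
   coth s - coth t = - sinh (s - t) / (sinh s sinh t) and its analogue for tanh. *)
Lemma sing_kernelB s t : s != 0 -> t != 0 ->
  sing_kernel s - sing_kernel t =
  - (expR (s - t) - expR (- (s - t))) *
  (half_csch s * half_csch t + ((expR s + expR (- s)) * (expR t + expR (- t)))^-1).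
Proof.
move=> s0 t0; rewrite /sing_kernel /half_csch.
have := expR_gap_neq0 s0; have := expR_gap_neq0 t0.
have := sym_expR_gt0 s; have := sym_expR_gt0 t.
have e2 x : 2 * x = x + x by lra.
rewrite !e2 !opprD !expRD opprK !expRN.
move: (expR_gt0 s) (expR_gt0 t).
move: (expR s) (expR t) => S T S0 T0 hT hS hT' hS'.
have e x : 0 < x -> x - x^-1 != 0 -> x * x - 1 != 0.
  move=> x0; apply: contra => /eqP x1; apply/eqP.
  have -> : x - x^-1 = (x * x - 1) / x by field; rewrite gt_eqF.
  by rewrite x1 mul0r.
have p x : 0 < x -> x * x + 1 != 0.
  by move=> x0; rewrite gt_eqF // ltr_wpDl // mulr_ge0 // ltW.
have q x : 0 < x -> x - x^-1 != 0 -> x * x * (x * x) - 1 != 0.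
  move=> x0 h; have -> : x * x * (x * x) - 1 = (x * x - 1) * (x * x + 1) by ring.
  by rewrite mulf_neq0 ?e ?p.
by field; rewrite !q ?p ?e // ?gt_eqF.
Qed.

(** The factor sinh (s - t) is of order d, and s and t are comparable: |t| <= |s| + d < 2 |s|, while
    exp (- |s|) and exp (- |t|) differ by at most exp (1/2) <= 2. Everything can thus be expressed
    at t alone. *)
Lemma sing_kernelB_le d s t : 0 < d -> d <= 2^-1 -> `|s - t| <= d ->
  2 * d < `|t| -> d < `|s| ->
  `|sing_kernel s - sing_kernel t| <=
    18 * (d * (expR (- 2 * `|t|) * (1 + `|t|^-1) ^+ 2)).
Proof.
move=> d0 d1 st td sd.
have t0 : 0 < `|t| by lra.
have s0 : 0 < `|s| by lra.
have ts : `|t| <= `|s| + d.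
  by rewrite -lerBlDl; apply: le_trans st; rewrite distrC lerB_dist.
have es : expR (- `|s|) <= 2 * expR (- `|t|).
  apply: le_trans (_ : expR (- `|t| + 2^-1) <= _); first by rewrite ler_expR; lra.
  by rewrite expRD mulrC ler_wpM2r ?expR_ge0 // expR_half_le2.
have isv : `|s|^-1 <= 2 * `|t|^-1.
  rewrite -[leRHS]invrK invfM invrK lef_pV2 ?posrE ?mulr_gt0 ?invr_gt0 //; lra.
have hd : `|expR (s - t) - expR (- (s - t))| <= 3 * d.
  by apply: le_trans (expR_gap_small _) _; lra.
rewrite sing_kernelB -?normr_gt0 // normrM normrN.
have hc : `|half_csch s * half_csch t| <=
    2 * expR (- `|t|) * (1 + 2 * `|t|^-1) * (expR (- `|t|) * (1 + `|t|^-1)).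
  rewrite normrM ler_pM //; last by rewrite half_csch_le -?normr_gt0.
  apply: le_trans (half_csch_le _) _; first by rewrite -normr_gt0.
  by rewrite ler_pM ?expR_ge0 ?addr_ge0 ?invr_ge0 // lerD2l.
have hp : `|((expR s + expR (- s)) * (expR t + expR (- t)))^-1| <=
    2 * expR (- `|t|) * expR (- `|t|).
  rewrite ger0_norm ?invr_ge0 ?mulr_ge0 ?sym_expR_ge0 // invfM.
  rewrite ler_pM ?invr_ge0 ?sym_expR_ge0 //.
  - exact: le_trans (sym_expRV_le _) es.
  - exact: sym_expRV_le.
apply: le_trans (ler_pM _ _ hd (ler_normD _ _)) _ => //.
apply: le_trans (ler_wpM2l _ (lerD hc hp)) _; first by lra.
have -> : - 2 * `|t| = - `|t| - `|t| by lra.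
rewrite expRD.
have v0 : 0 < `|t|^-1 by rewrite invr_gt0.
move: (expR (- `|t|)) (expR_gt0 (- `|t|)) `|t|^-1 v0 => E E0 v v0.
rewrite -subr_ge0.
have -> : 18 * (d * (E * E * (1 + v) ^+ 2)) -
  3 * d * (2 * E * (1 + 2 * v) * (E * (1 + v)) + 2 * E * E) =
  d * (E * E) * (6 * (1 + 3 * v + v ^+ 2)) by ring.
by rewrite !mulr_ge0 // ?ltW // !addr_gt0 ?mulr_gt0 ?exprn_gt0.
Qed.

Definition trunc_kernel d t : R := if d < `|t| then sing_kernel t else 0.

Lemma trunc_kernelN d t : trunc_kernel d (- t) = - trunc_kernel d t.
Proof. by rewrite /trunc_kernel normrN sing_kernelN; case: ifP; rewrite ?oppr0. Qed.

Lemma trunc_kernel_le d t : 0 <= d ->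
  `|trunc_kernel d t| <=
  if d < `|t| then 2 * (expR (- 2 * `|t|) * (1 + `|t|^-1)) else 0.
Proof.
move=> d0; rewrite /trunc_kernel; case: ifP => [dt|]; last by rewrite normr0.
by rewrite sing_kernel_le // -normr_gt0 (le_lt_trans d0).
Qed.

(** If |t| <= d then |s| <= 2 d and both kernels are cut off. If exactly one is cut off then d < |t|
    <= 3 d, and the size of the other already fits under the difference bound. *)
Lemma trunc_kernelB_le d s t : 0 < d -> d <= 2^-1 -> `|s - t| <= d ->
  `|trunc_kernel (2 * d) s - trunc_kernel (2 * d) t| <=
  if d < `|t| then 18 * (d * (expR (- 2 * `|t|) * (1 + `|t|^-1) ^+ 2)) else 0.
Proof.
move=> d0 d1 st.
have ts : `|t| <= `|s| + d.
  by rewrite -lerBlDl; apply: le_trans st; rewrite distrC lerB_dist.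
have ss : `|s| <= `|t| + d by rewrite -lerBlDl; apply: le_trans st; rewrite lerB_dist.
(* For |t| <= 3 d the factor 3 d / |t| is at least 1, which turns a size bound into a difference
   bound. *)
have amp : 0 < `|t| -> `|t| <= 3 * d ->
    2 * (expR (- 2 * `|t|) * (1 + `|t|^-1)) <=
    18 * (d * (expR (- 2 * `|t|) * (1 + `|t|^-1) ^+ 2)).
  move=> t0 t3.
  have hd : 1 <= 3 * (d * `|t|^-1).
    by rewrite mulrA -[leLHS](divff (lt0r_neq0 t0)) ler_wpM2r // invr_ge0.
  have v0 : 0 < `|t|^-1 by rewrite invr_gt0.
  move: (expR_gt0 (- 2 * `|t|)) v0 hd.
  move: (expR (- 2 * `|t|)) `|t|^-1 => E v E0 v0 hd.
  rewrite -subr_ge0.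
  have -> : 18 * (d * (E * (1 + v) ^+ 2)) - 2 * (E * (1 + v)) =
    E * (1 + v) * (18 * d + 6 * (3 * (d * v)) - 2) by ring.
  by apply: mulr_ge0; [apply: mulr_ge0; lra|lra].
rewrite /trunc_kernel; case: (ltrP (2 * d)) => [sd|sd]; case: (ltrP (2 * d)) => [td|td].
- by rewrite ifT ?sing_kernelB_le //; lra.
- have dt : d < `|t| by lra.
  have t0 : 0 < `|t| by lra.
  rewrite dt subr0; apply: le_trans (sing_kernel_le _) _.
    by rewrite -normr_gt0; lra.
  apply: (@le_trans _ _ (2 * (expR (- 2 * `|t|) * (1 + `|t|^-1)))).
    rewrite ler_wpM2l // ler_pM ?expR_ge0 ?addr_ge0 ?invr_ge0 // ?ler_expR ?lerD2l.
      lra.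
    by rewrite lef_pV2 ?posrE; lra.
  apply: amp => //; lra.
- have t0 : 0 < `|t| by lra.
  rewrite ifT ?sub0r ?normrN; last by lra.
  apply: le_trans (sing_kernel_le _) _; first by rewrite -normr_gt0.
  apply: amp => //; lra.
- by rewrite subrr normr0; case: ifP => // _; rewrite !mulr_ge0 ?expR_ge0 ?sqr_ge0 ?ltW.
Qed.

Lemma reg_kernel_le y eta :
  `|reg_kernel y eta| <= expR (`|y| - `|y - eta| - `|eta|).
Proof.
rewrite /reg_kernel normrM normfV.
rewrite [X in _ / X]ger0_norm ?mulr_ge0 ?sym_expR_ge0 //.
rewrite ler_pdivrMr ?mulr_gt0 ?sym_expR_gt0 //.
apply: le_trans (abs_expR_gap_le _) _.
rewrite -addrA -opprD (expRD `|y|) -mulrA ler_peMr ?expR_ge0 //.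
rewrite (expRN (`|y - eta| + `|eta|)) ler_pdivlMl ?expR_gt0 // mulr1.
by rewrite (expRD `|y - eta|) ler_pM ?expR_ge0 ?sym_expR_ge.
Qed.

(** In the difference tanh eta cancels and (tanh s - tanh t) / 2 is left. Hence the increment decays
    at rate 2 on both sides, although the kernel itself is of order 1 all the way from 0 to y. *)
Lemma reg_kernelB s t eta :
  reg_kernel (s + eta) eta - reg_kernel (t + eta) eta =
  (expR (s - t) - expR (- (s - t))) /
  ((expR s + expR (- s)) * (expR t + expR (- t))).
Proof.
rewrite /reg_kernel !addrK !opprD !expRD opprK !expRN.
move: (expR_gt0 s) (expR_gt0 t) (expR_gt0 eta).
move: (expR s) (expR t) (expR eta) => S T E S0 T0 E0.
have p (z : R) : 0 < z -> z * z + 1 != 0.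
  by move=> z0; rewrite gt_eqF // ltr_wpDl // mulr_ge0 // ltW.
by field; rewrite !p // !gt_eqF.
Qed.

Lemma reg_kernelB_le d x y eta : 0 < d -> d <= 2^-1 -> `|x - y| <= d ->
  `|reg_kernel x eta - reg_kernel y eta| <= 6 * (d * expR (- 2 * `|y - eta|)).
Proof.
move=> d0 d1 xy.
pose s := x - eta; pose t := y - eta.
have ts : `|t| <= `|s| + d.
  rewrite -lerBlDl; apply: le_trans xy; rewrite (distrC x y).
  by have -> : y - x = t - s; [rewrite /s /t; ring|exact: lerB_dist].
have -> : reg_kernel x eta - reg_kernel y eta =
  (expR (x - y) - expR (- (x - y))) /
  ((expR s + expR (- s)) * (expR t + expR (- t))).
  have := reg_kernelB s t eta; rewrite /s /t !subrK => ->.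
  by have -> : x - eta - (y - eta) = x - y by ring.
rewrite normrM.
have hd : `|expR (x - y) - expR (- (x - y))| <= 3 * d.
  by apply: le_trans (expR_gap_small _) _; lra.
have -> : 6 * (d * expR (- 2 * `|y - eta|)) = 3 * d * (2 * expR (- 2 * `|t|)).
  by rewrite -/t; ring.
rewrite ler_pM // ger0_norm ?invr_ge0 ?mulr_ge0 ?sym_expR_ge0 // invfM.
have -> : - 2 * `|t| = - `|t| - `|t| by lra.
rewrite (expRD (- `|t|) (- `|t|)) mulrA ler_pM ?invr_ge0 ?sym_expR_ge0 ?sym_expRV_le //.
apply: le_trans (sym_expRV_le _) _.
apply: le_trans (_ : expR (- `|t| + 2^-1) <= _); first by rewrite ler_expR; lra.
by rewrite expRD mulrC ler_wpM2r ?expR_ge0 // expR_half_le2.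
Qed.

(** At [eta = y] the left side takes the default value 0 while the right side is tanh y / 2. *)
Lemma kernel_split y eta : eta != y ->
  (expR (- y) + expR y) * (half_csch (y - eta) / (expR (- eta) + expR eta)) =
  sing_kernel (y - eta) + reg_kernel y eta.
Proof.
move=> ye; rewrite /reg_kernel /sing_kernel /half_csch.
have t0 : y - eta != 0 by rewrite subr_eq0 eq_sym.
(* In terms of t = y - eta the claim is an identity of rational functions of exp t and exp eta. *)
rewrite -[in RHS](subrK eta y) -[in LHS](subrK eta y) !addrK.
move: (y - eta) t0 => t t0.
have e2 x : 2 * x = x + x by lra.
rewrite !e2 !opprD !expRD !expRN.
have := expR_gap_neq0 t0; rewrite expRN.
move: (expR_gt0 t) (expR_gt0 eta).
move: (expR t) (expR eta) => T E T0 E0 hT.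
have hT' : T * T - 1 != 0.
  move: hT; apply: contra => /eqP x1; apply/eqP.
  have -> : T - T^-1 = (T * T - 1) / T by field; rewrite gt_eqF.
  by rewrite x1 mul0r.
have p (z : R) : 0 < z -> z * z + 1 != 0.
  by move=> z0; rewrite gt_eqF // ltr_wpDl // mulr_ge0 // ltW.
have q : T * T * (T * T) - 1 != 0.
  have -> : T * T * (T * T) - 1 = (T * T - 1) * (T * T + 1) by ring.
  by rewrite mulf_neq0 ?p.
field; rewrite q !p ?hT' // ?gt_eqF //.
Qed.
End Kernels.

(** * Integrals on the line *)

(** The total inverse is discontinuous at 0. In the product with a power of x ^+ 2 the factor x
    restores the sign and gives the value 0 at 0. *)
Lemma measurable_invr (R : realType) : measurable_fun [set: R] (@GRing.inv R).
Proof.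
have -> : @GRing.inv R = fun x => x * (x ^+ 2) `^ (-1).
  apply/funext => x; rewrite powR_inv1 ?sqr_ge0 //.
  have [->|x0] := eqVneq x 0; first by rewrite invr0 mul0r.
  by field.
apply: measurable_funM => //.
by apply: (measurableT_comp (measurable_powR _)); exact: measurable_funX.
Qed.

Ltac meas := repeat first
  [ exact: measurable_id
  | exact: measurable_cst
  | assumption
  | match goal with
    | |- measurable_fun _ (fun x => if _ then _ else _) => apply: measurable_fun_ifT
    | |- measurable_fun _ (fun x => _ && _) => apply: measurable_and
    | |- measurable_fun _ (fun x => _ < _) => apply: measurable_fun_ltr
    | |- measurable_fun _ (Order.lt _) => apply: measurable_fun_ltr
    | |- measurable_fun _ (Order.le _) => apply: measurable_fun_ler
    | |- measurable_fun _ (fun x => _ <= _) => apply: measurable_fun_ler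
    | |- measurable_fun _ (fun x => (_ x)%:E) => apply/measurable_EFinP
    | |- measurable_fun _ (fun x => EFin _) => apply/measurable_EFinP
    | |- measurable_fun _ (EFin \o _) => apply/measurable_EFinP
    | |- measurable_fun _ (fun x => _ + _) => apply: measurable_funD
    | |- measurable_fun _ (fun x => - _) => apply: measurable_funN
    | |- measurable_fun _ (fun x => _ * _) => apply: measurable_funM
    | |- measurable_fun _ (fun x => _ ^+ _) => apply: measurable_funX
    | |- measurable_fun _ (fun x => _ ^-1) =>
        apply: (measurableT_comp (@measurable_invr _))
    | |- measurable_fun _ (fun x => expR _) =>
        apply: (measurableT_comp (@measurable_expR _))
    | |- measurable_fun _ (fun x => ln _) =>
        apply: (measurableT_comp (@measurable_ln _))
    | |- measurable_fun _ (fun x => `|_|) =>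
        apply: (measurableT_comp (@normr_measurable _ _))
    | |- measurable_fun _ (fun x => _ `^ _) =>
        apply: (measurableT_comp (measurable_powR _))
    | f : _ |- measurable_fun _ (fun x => ?f (@?g x)) =>
        apply: (@measurableT_comp _ _ _ _ _ _ f)
    end ].

Section MeasurableKernels.
Variable R : realType.
Lemma measurable_trunc_kernel d : measurable_fun setT (@trunc_kernel R d).
Proof.
rewrite /trunc_kernel /sing_kernel /half_csch; by meas.
Qed.

Lemma measurable_reg_kernel y : measurable_fun setT (@reg_kernel R y).
Proof. rewrite /reg_kernel; by meas. Qed.

End MeasurableKernels.

Section Integrals.
Variable R : realType.
Local Notation mu := (@lebesgue_measure R).

(** By uniqueness only half-open intervals have to be compared; the reflection moves the closed end
    to the other side and keeps the length. *)
Lemma lebesgue_measure_reflect (y : R) (A : set R) : measurable A ->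
  pushforward mu ((fun t => y - t) : _ -> measurableTypeR R) A = mu A.
Proof.
have mf : measurable_fun setT (fun t : R => y - t) by meas.
move=> mA; apply/esym/lebesgue_measure_unique => //= _ [[a b]] _ <-.
rewrite /pushforward.
have -> : (fun t : R => y - t) @^-1` `]a, b]%classic = `[y - b, y - a[%classic.
  apply/seteqP; split => t /=; rewrite !in_itv /= => /andP[h1 h2];
    apply/andP; split; lra.
rewrite !lebesgue_measure_itv /= !lte_fin ltrD2l ltrN2; case: ifP => // _.
by rewrite -!EFinD; congr EFin; ring.
Qed.

Lemma ge0_integral_reflect (y : R) (f : R -> \bar R) :
  measurable_fun setT f -> (forall x, 0 <= f x)%E ->
  (\int[mu]_t f (y - t)%R = \int[mu]_t f t)%E.
Proof.
move=> mf f0.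
have my : measurable_fun setT (fun t : R => y - t) by meas.
transitivity (\int[pushforward mu ((fun t => y - t)%R : R -> measurableTypeR R)]_t f t)%E.
  by rewrite ge0_integral_pushforward // preimage_setT.
by apply: eq_measure_integral => //= A mA _; exact: lebesgue_measure_reflect.
Qed.

Lemma integrable_reflect (y : R) (f : R -> R) :
  mu.-integrable setT (EFin \o f) -> mu.-integrable setT (EFin \o (fun t => f (y - t))).
Proof.
move=> /integrableP[mf fi]; apply/integrableP; split.
  by move/measurable_EFinP : mf => mf; meas.
rewrite (ge0_integral_reflect y (f := fun t => `|(EFin \o f) t|%E)) //.
exact: measurableT_comp.
Qed.

Lemma Rintegral_reflect (y : R) (f : R -> R) :
  mu.-integrable setT (EFin \o f) ->
  (\int[mu]_t f (y - t) = \int[mu]_t f t).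
Proof.
move=> fi; have /integrableP[mf _] := fi.
have my : measurable_fun setT (fun t : R => y - t) by meas.
congr fine.
transitivity
  (\int[pushforward mu ((fun t => y - t)%R : R -> measurableTypeR R)]_t (f t)%:E)%E.
  rewrite integral_pushforward // ?preimage_setT //; exact: integrable_reflect.
by apply: eq_measure_integral => //= A mA _; exact: lebesgue_measure_reflect.
Qed.

Lemma odd_Rintegral0 (y : R) (f : R -> R) : (forall t, f (- t) = - f t) ->
  mu.-integrable setT (EFin \o f) -> \int[mu]_t f (y - t) = 0.
Proof.
move=> fN fi; rewrite Rintegral_reflect //.
have := Rintegral_reflect 0 fi.
under eq_Rintegral do rewrite sub0r fN -mulN1r.
rewrite RintegralZl // => h; lra.
Qed.

(** Common form of the estimates below: one majorant, integrated in the extended reals, yields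
    integrability and the numerical bound together. *)
Lemma Rintegral_bound (f g : R -> R) B :
  measurable_fun setT f -> measurable_fun setT g ->
  (forall x, `|f x| <= g x) -> (\int[mu]_x (g x)%:E <= B%:E)%E ->
  mu.-integrable setT (EFin \o f) /\ `|\int[mu]_x f x| <= B.
Proof.
move=> mf mg fg gB.
have le : (\int[mu]_x `|(EFin \o f) x| <= B%:E)%E.
  apply: le_trans gB; apply: ge0_le_integral => //=.
  - by meas.
  - by meas.
  - by move=> x _; rewrite lee_fin.
have fi : mu.-integrable setT (EFin \o f).
  by apply/integrableP; split; [meas|rewrite (le_lt_trans le) ?ltry].
split=> //; rewrite -lee_fin EFin_normr_Rintegral //.
apply: le_trans le; apply: le_abse_integral => //; by meas.
Qed.

Lemma ge0_integral_norm (f : R -> R) : measurable_fun setT f ->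
  (forall x, 0 <= f x) ->
  (\int[mu]_x (f `|x|)%:E = 2%:E * \int[mu]_(x in `[0%R, +oo[) (f x)%:E)%E.
Proof.
move=> mf f0.
have hU : [set: R] = `]-oo, 0%R] `|` `]0%R, +oo[.
  by rewrite -[RHS]setCK setCU setCitvl setCitvr; apply/seteqP; split => // x _ [] /=;
    rewrite !in_itv /= ?andbT; lra.
rewrite [X in (\int[_]_(x in X) _)%E]hU ge0_integral_setU //=.
- rewrite mule_natl mule2n; congr (_ + _)%E.
    transitivity (\int[mu]_(x in `]-oo, 0%R]) (f (- x))%:E)%E.
      by apply: eq_integral => x; rewrite inE /= in_itv /= => x0; rewrite ler0_norm.
    rewrite -(ge0_integration_by_substitution0 (f := EFin \o f)) //=; first by meas.
  rewrite -integral_itv_obnd_cbnd; last exact/measurable_EFinP/measurable_funTS.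
  by apply: eq_integral => x; rewrite inE /= in_itv /= andbT => x0; rewrite gtr0_norm.
- by rewrite -hU; meas.
- by move=> x _; rewrite lee_fin.
- apply/disj_setPS => x [] /=; rewrite !in_itv /= andbT => h1; by rewrite ltNge h1.
Qed.

(** Each half line contributes 1 / c, by the normalisation of the exponential density. *)
Lemma integral_expR_norm (c : R) : 0 < c ->
  (\int[mu]_x (expR (- c * `|x|))%:E = (2 / c)%:E)%E.
Proof.
move=> c0.
have m1 : measurable_fun setT (fun x : R => expR (- c * x)) by meas.
rewrite (ge0_integral_norm m1); last by move=> x; exact: expR_ge0.
have : (\int[mu]_(x in `[0%R, +oo[) (c * expR (- c * x))%:E = 1)%E.
  rewrite -(integral_exponential_pdf c0) [LHS]integral_mkcond.
  by apply: eq_integral => x _; rewrite !patchE /exponential_pdf patchE; case: ifP.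
under eq_integral do rewrite EFinM.
rewrite (ge0_integralZl_EFin mu _ _ _ (ltW c0)) //=.
- move=> h; have -> : 2%:E = ((2 / c)%:E * c%:E)%E by rewrite -EFinM divfK ?gt_eqF.
  by rewrite -muleA h mule1.
- exact/measurable_EFinP/measurable_funTS.
Qed.

Lemma integral_expR_dist (y k k' : R) : 0 <= k -> 0 < k' ->
  (\int[mu]_eta (k * expR (- k' * `|y - eta|))%:E = (k * (2 / k'))%:E)%E.
Proof.
move=> k0 k'0.
have m : measurable_fun setT (fun t : R => (k * expR (- k' * `|t|))%:E) by meas.
rewrite (ge0_integral_reflect y m) => [|x]; last by rewrite lee_fin mulr_ge0 ?expR_ge0.
under eq_integral do rewrite EFinM.
rewrite ge0_integralZl_EFin //=; last by meas.
by rewrite integral_expR_norm // -EFinM.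
Qed.

Lemma integral_FTC (f F : R -> R) (a b : R) : a < b ->
  (forall x, a <= x <= b -> is_derive x 1 F (f x)) ->
  (forall x, a <= x <= b -> derivable f x 1) ->
  (\int[mu]_(x in `[a, b]) (f x)%:E = (F b - F a)%:E)%E.
Proof.
move=> ab dF df.
have cF x : a <= x <= b -> {for x, continuous F}.
  by move=> xab; apply: differentiable_continuous; apply/derivable1_diffP; case: (dF x xab).
have cf x : a <= x <= b -> {for x, continuous f}.
  by move=> xab; apply: differentiable_continuous; apply/derivable1_diffP; exact: df.
rewrite (@continuous_FTC2 _ _ F) //.
- apply: continuous_in_subspaceT => x; rewrite inE /= in_itv /=; exact: cf.
- split.
  + move=> x; rewrite in_itv /= => /andP[h1 h2]; case: (dF x) => //; lra.
  + by apply: cvg_at_right_filter; apply: cF; lra.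
  + by apply: cvg_at_left_filter; apply: cF; lra.
- move=> x; rewrite in_itv /= => /andP[h1 h2]; rewrite derive1E.
  by have [] : is_derive x 1 F (f x) by apply: dF; lra.
Qed.

Lemma integral_if_itv (f : R -> R) (a b : R) : measurable_fun setT f -> 0 <= a ->
  (\int[mu]_(x in `[0%R, +oo[) (if a < x <= b then f x else 0)%:E =
   \int[mu]_(x in `[a, b]) (f x)%:E)%E.
Proof.
move=> mf a0.
rewrite -integral_itv_obnd_cbnd; last by apply: measurable_funTS; meas.
rewrite integral_mkcond [RHS]integral_mkcond; apply: eq_integral => x _.
rewrite !patchE.
have [h1|h1] := boolP (a < x <= b).
  by rewrite !mem_set //= in_itv /= ?andbT; lra.
rewrite [in RHS]memNset /= ?in_itv /=; last exact/negP.
by case: ifP.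
Qed.

Lemma integral_powR_itv (a b p : R) : 0 < a -> a <= b -> p != 0 ->
  (\int[mu]_(x in `[a, b]) (x `^ (p - 1))%:E = ((b `^ p - a `^ p) / p)%:E)%E.
Proof.
move=> a0; rewrite le_eqVlt => /predU1P[->|ab] p0.
  by rewrite set_itv1 integral_set1 subrr mul0r.
rewrite mulrBl; apply: (@integral_FTC _ (fun x => x `^ p / p)) => //.
- move=> x /andP[ax _]; have x0 := lt_le_trans a0 ax.
  have -> : x `^ (p - 1) = p^-1 *: (p * x `^ (p - 1)) by rewrite scalerA mulVf // scale1r.
  have -> : (fun x => x `^ p / p) = p^-1 \*: (fun x : R => x `^ p).
    by apply/funext => z; rewrite /= mulrC.
  by apply: is_deriveZ; exact: is_derive1_powR.
- move=> x /andP[ax _]; apply: derivable_powR.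
  by rewrite in_itv /= andbT (lt_le_trans a0 ax).
Qed.

(** The exponent p may have either sign: p = alpha serves the convergence of the truncations, p =
    alpha - 1 the comparison of two points. *)
Lemma integral_powR_shell (a b p : R) : 0 < a -> a <= b -> p != 0 ->
  (\int[mu]_t (if a < `|t| <= b then `|t| `^ (p - 1) else 0)%:E =
   (2 * ((b `^ p - a `^ p) / p))%:E)%E.
Proof.
move=> a0 ab p0.
have m1 : measurable_fun setT (fun t : R => if a < t <= b then t `^ (p - 1) else 0) by meas.
rewrite (ge0_integral_norm m1); last by move=> t; case: ifP => // _; exact: powR_ge0.
rewrite (integral_if_itv b (measurable_powR (p - 1)) (ltW a0)).
by rewrite integral_powR_itv // -EFinM.
Qed.

(** The source of the logarithm for the weight of exponent -1. *)
Lemma integral_inv_ball (b : R) : 0 <= b ->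
  (\int[mu]_t (if `|t| <= b then (1 + `|t|)^-1 else 0)%:E = (2 * ln (1 + b))%:E)%E.
Proof.
move=> b0.
have m1 : measurable_fun setT (fun t : R => if t <= b then (1 + `|t|)^-1 else 0) by meas.
(* The inner absolute value keeps the profile nonnegative on negative arguments, as
   [ge0_integral_norm] requires. *)
transitivity (\int[mu]_t (if `|t| <= b then (1 + `|(`|t|)|)^-1 else 0)%:E)%E.
  by apply: eq_integral => x _; rewrite normr_id.
rewrite (ge0_integral_norm m1); last first.
  by move=> t; case: ifP => // _; rewrite invr_ge0 addr_ge0.
transitivity (2%:E * \int[mu]_(x in `[0%R, b]) (1 + `|x|)^-1%:E)%E.
  congr (_ * _)%E.
  rewrite -integral_itv_obnd_cbnd; last exact/measurable_EFinP/measurable_funTS.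
  have m2 : measurable_fun setT (fun t : R => (1 + `|t|)^-1) by meas.
  rewrite -(integral_if_itv _ m2) // -[RHS]integral_itv_obnd_cbnd; last first.
    by apply/measurable_EFinP/measurable_funTS; meas.
  by apply: eq_integral => x; rewrite inE /= in_itv /= andbT => ->.
transitivity (2%:E * \int[mu]_(x in `[0%R, b]) (1 + x)^-1%:E)%E.
  congr (_ * _)%E; apply: eq_integral => x; rewrite inE /= in_itv /= => /andP[x0 _].
  by rewrite ger0_norm.
move: b0; rewrite le_eqVlt => /predU1P[<-|b0].
  by rewrite set_itv1 integral_set1 addr0 ln1 mulr0 mule0.
suff -> : (\int[mu]_(x in `[0%R, b]) (1 + x)^-1%:E = (ln (1 + b) - ln (1 + 0))%:E)%E.
  by rewrite addr0 ln1 subr0 -EFinM.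
apply: (@integral_FTC _ (fun x => ln (1 + x))) => //.
- move=> x /andP[x0 _].
  have x1 : 0 < 1 + x by rewrite ltr_pwDl.
  have d : is_derive x 1 (fun x : R => 1 + x) 1.
    by apply: is_derive_eq; rewrite add0r mulr1.
  by have := is_derive1_comp (is_derive1_ln x1) d; rewrite mulr1.
- move=> x /andP[x0 _].
  by apply: derivableV => //; rewrite gt_eqF // ltr_pwDl.
Qed.

Lemma integral_cst_ball (b c : R) : 0 <= b ->
  (\int[mu]_t (if `|t| <= b then c else 0)%:E = (c * (2 * b))%:E)%E.
Proof.
move=> b0.
transitivity (\int[mu]_(t in `[(- b)%R, b]) c%:E)%E.
  rewrite [RHS]integral_mkcond; apply: eq_integral => x _; rewrite patchE.
  have -> : (x \in [set` `[- b, b]]) = (`|x| <= b) by rewrite mem_setE in_itv /= ler_norml.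
  by case: ifP.
rewrite integral_cst //= lebesgue_measure_itv /= lte_fin; case: ltP => h.
  by rewrite opprK -EFinD -EFinM; congr EFin; ring.
have b00 : b = 0 by lra.
by rewrite b00 !mulr0 mule0.
Qed.

End Integrals.

Ltac nneg := repeat first [ done | exact: expR_ge0 | exact: powR_ge0 | exact: sqr_ge0
  | exact: ltW | apply: mulr_ge0 | apply: addr_ge0 | rewrite invr_ge0 ].

(** * The operator on real functions *)

(* The intervals P e +- K e^alpha meet pairwise. *)
Lemma shrinking_bounds_limit (R : realType) (P : R -> R) (K alpha : R) :
  0 < alpha -> 0 <= K ->
  (forall a b, 0 < a -> a <= b -> b <= 1 -> `|P a - P b| <= K * b `^ alpha) ->
  exists l, forall e, 0 < e -> e <= 1 -> `|P e - l| <= K * e `^ alpha.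
Proof.
move=> a0 K0 hP.
(* The limit is the supremum of the left ends; every right end is an upper bound of them. *)
pose S := [set P e - K * e `^ alpha | e in [set e | 0 < e <= 1]].
have hub b : 0 < b -> b <= 1 -> ubound S (P b + K * b `^ alpha).
  move=> b0 b1 _ [a /= /andP[a1 a2] <-].
  have pa : 0 <= K * a `^ alpha by rewrite mulr_ge0 ?powR_ge0.
  have pb : 0 <= K * b `^ alpha by rewrite mulr_ge0 ?powR_ge0.
  have [ab|ba] := lerP a b.
    by have := hP a b a1 ab b1; rewrite ler_norml => /andP[]; lra.
  by have := hP b a b0 (ltW ba) a2; rewrite ler_norml => /andP[]; lra.
exists (sup S) => e e0 e1.
have Se : S (P e - K * e `^ alpha) by exists e => //=; rewrite e0.
have h1 : P e - K * e `^ alpha <= sup S.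
  by apply: ub_le_sup => //; exists (P e + K * e `^ alpha); exact: hub.
have h2 : sup S <= P e + K * e `^ alpha.
  by apply: ge_sup; [exists (P e - K * e `^ alpha)|exact: hub].
by rewrite ler_norml; lra.
Qed.

Section RealOperator.
Variable R : realType.
Local Notation mu := (@lebesgue_measure R).
Variables (alpha : R) (w w' : R -> R) (A rho : R).
Hypotheses (alpha_gt0 : 0 < alpha) (alpha_lt1 : alpha < 1).
Hypotheses (rho_ge0 : 0 <= rho) (rho_lt2 : rho < 2) (A_ge1 : 1 <= A).
Hypothesis w_gt0 : forall x, 0 < w x.
Hypothesis mw : measurable_fun setT w.
Hypothesis w_moderate : forall x y, w x <= A * expR (rho * `|y - x|) * w y.
Hypothesis w_integral : forall y,
  (\int[mu]_eta (expR (`|y| - `|y - eta| - `|eta|) * w eta)%:E <= (A * w' y)%:E)%E.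
Hypothesis w_le : forall y, w y <= A * w' y.

Variables (f : R -> R) (C0 : R).
Hypothesis mf : measurable_fun setT f.
Hypothesis f_le : forall x, `|f x| <= C0 * w x.
Hypothesis fB_le : forall x y, `|f x - f y| <= C0 * `|x - y| `^ alpha * (w x + w y).

(** The decay that remains once the rate 2 of the kernels has paid for the growth [rho] of the
    weight. *)
Let c := 2 - rho.
Let c_gt0 : 0 < c. Proof. by rewrite /c subr_gt0. Qed.

Let C0_ge0 : 0 <= C0.
Proof. by rewrite -(pmulr_lge0 _ (w_gt0 0)) (le_trans _ (f_le 0)). Qed.

Let A_gt0 : 0 < A. Proof. exact: lt_le_trans A_ge1. Qed.

Lemma f_le_at y eta : `|f eta| <= C0 * (A * w y) * expR (rho * `|y - eta|).
Proof.
apply: le_trans (f_le _) _; rewrite -mulrA ler_wpM2l //.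
by apply: le_trans (w_moderate _ y) _; rewrite mulrAC.
Qed.

(** The weight is moved to the base point y. Since A >= 1 and rho >= 0, w y obeys the same bound as
    w eta, whence the factor 2. *)
Lemma fB_le_at y eta :
  `|f eta - f y| <= 2 * (C0 * (A * w y)) * (expR (rho * `|y - eta|) * `|y - eta| `^ alpha).
Proof.
apply: le_trans (fB_le _ _) _; rewrite (distrC eta).
have wy := w_gt0 y.
have h1 : w y <= A * expR (rho * `|y - eta|) * w y.
  by rewrite ler_peMl ?(ltW (w_gt0 _)) //; rewrite mulr_ege1 // -expR0 ler_expR mulr_ge0.
have h : w eta + w y <= 2 * (A * expR (rho * `|y - eta|) * w y).
  by have := w_moderate eta y; lra.
have -> : 2 * (C0 * (A * w y)) * (expR (rho * `|y - eta|) * `|y - eta| `^ alpha) =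
  C0 * `|y - eta| `^ alpha * (2 * (A * expR (rho * `|y - eta|) * w y)) by ring.
by rewrite ler_wpM2l // mulr_ge0 // powR_ge0.
Qed.

Let expRc t : expR (- 2 * t) * expR (rho * t) = expR (- c * t).
Proof. by rewrite -expRD /c; congr expR; ring. Qed.

(** * The smooth part *)

Definition reg_part y : R := \int[mu]_eta (reg_kernel y eta * f eta).

(** The one estimate that uses [w_integral], and so the one where a target weight larger than w can
    be forced. *)
Lemma reg_part_int y :
  mu.-integrable setT (EFin \o (fun eta => reg_kernel y eta * f eta)) /\
  `|reg_part y| <= C0 * A * w' y.
Proof.
apply: (@Rintegral_bound R _
  (fun eta => C0 * (expR (`|y| - `|y - eta| - `|eta|) * w eta))).
- by apply: measurable_funM => //; exact: measurable_reg_kernel.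
- by meas.
- by move=> eta; rewrite normrM mulrCA ler_pM // reg_kernel_le.
- under eq_integral do rewrite EFinM.
  rewrite ge0_integralZl_EFin //=; last 2 first.
  + by move=> x _; rewrite lee_fin mulr_ge0 ?expR_ge0 ?ltW.
  + by meas.
  by rewrite -mulrA EFinM lee_wpmul2l // lee_fin.
Qed.

Lemma reg_partB d x y : 0 < d -> d <= 2^-1 -> `|x - y| <= d ->
  `|reg_part x - reg_part y| <= 12 / c * (C0 * (A * w y)) * d.
Proof.
move=> d0 d1 xy.
have [ix _] := reg_part_int x; have [iy _] := reg_part_int y.
rewrite /reg_part -RintegralB //.
have K0 : 0 <= C0 * (A * w y) by nneg.
have [] := @Rintegral_bound R
  (fun eta => reg_kernel x eta * f eta - reg_kernel y eta * f eta)
  (fun eta => 6 * d * (C0 * (A * w y)) * expR (- c * `|y - eta|))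
  (12 / c * (C0 * (A * w y)) * d).
- by apply: measurable_funB; apply: measurable_funM => //; exact: measurable_reg_kernel.
- by meas.
- move=> eta; rewrite -mulrBl normrM -expRc.
  apply: le_trans (ler_pM _ _ (reg_kernelB_le _ d0 d1 xy) (f_le_at y eta)) _ => //.
  by rewrite le_eqVlt; apply/orP; left; apply/eqP; ring.
- rewrite integral_expR_dist //; last by nneg.
  by rewrite lee_fin le_eqVlt; apply/orP; left; apply/eqP; ring.
by [].
Qed.

(** * The truncated singular part *)

Definition sing_part eps y : R := \int[mu]_eta (trunc_kernel eps (y - eta) * f eta).

Let meas_trunc eps y : measurable_fun setT (fun eta : R => trunc_kernel eps (y - eta)).
Proof. by apply: (measurableT_comp (@measurable_trunc_kernel R eps)); meas. Qed.

Lemma sing_part_int eps y : 0 < eps ->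
  mu.-integrable setT (EFin \o (fun eta => trunc_kernel eps (y - eta) * f eta)) /\
  `|sing_part eps y| <= 4 / c * (1 + eps^-1) * (C0 * (A * w y)).
Proof.
move=> e0.
have K0 : 0 <= C0 * (A * w y) by nneg.
have e1 : 0 <= 1 + eps^-1 by rewrite addr_ge0 // invr_ge0 ltW.
apply: (@Rintegral_bound R _
  (fun eta => 2 * (1 + eps^-1) * (C0 * (A * w y)) * expR (- c * `|y - eta|))).
- exact: measurable_funM.
- by meas.
- move=> eta; rewrite normrM -expRc.
  apply: le_trans
    (ler_pM (y1 := 2 * (expR (- 2 * `|y - eta|) * (1 + eps^-1))) _ _ _ (f_le_at y eta)) _ => //.
    apply: le_trans (trunc_kernel_le _ (ltW e0)) _.
    case: ifP => [h|_]; last by rewrite !mulr_ge0 ?expR_ge0.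
    rewrite !ler_wpM2l ?expR_ge0 // lerD2l lef_pV2 ?posrE ?ltW //.
    exact: lt_trans h.
  by rewrite le_eqVlt; apply/orP; left; apply/eqP; ring.
- rewrite integral_expR_dist //; last by nneg.
  by rewrite lee_fin le_eqVlt; apply/orP; left; apply/eqP; ring.
Qed.

Lemma trunc_kernel_int eps y : 0 < eps ->
  mu.-integrable setT (EFin \o (fun eta => trunc_kernel eps (y - eta))) /\
  \int[mu]_eta trunc_kernel eps (y - eta) = 0.
Proof.
move=> e0.
have e1 : 0 <= 1 + eps^-1 by rewrite addr_ge0 // invr_ge0 ltW.
have [i0 _] : mu.-integrable setT (EFin \o trunc_kernel eps) /\
    `|\int[mu]_t trunc_kernel eps t| <= 2 * (1 + eps^-1).
  apply: (@Rintegral_bound R _ (fun t => 2 * (1 + eps^-1) * expR (- 2 * `|0 - t|))).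
  - exact: measurable_trunc_kernel.
  - by meas.
  - move=> t; rewrite sub0r normrN; apply: le_trans (trunc_kernel_le _ (ltW e0)) _.
    case: ifP => [h|_]; last by rewrite !mulr_ge0 ?expR_ge0.
    rewrite mulrAC -mulrA ler_wpM2l // ler_wpM2l ?expR_ge0 // lerD2l lef_pV2 ?posrE ?ltW //.
    exact: lt_trans h.
  - rewrite integral_expR_dist ?mulr_ge0 //.
    by rewrite lee_fin divff // mulr1.
split; first exact: (integrable_reflect y i0).
by apply: odd_Rintegral0 => //; exact: trunc_kernelN.
Qed.

(* The truncated kernel has mean zero, so any constant may be subtracted from [f]. *)
Lemma sing_partE eps y k : 0 < eps ->
  mu.-integrable setT (EFin \o (fun eta => trunc_kernel eps (y - eta) * (f eta - k))) /\
  sing_part eps y = \int[mu]_eta (trunc_kernel eps (y - eta) * (f eta - k)).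
Proof.
move=> e0; have [i1 _] := sing_part_int y e0; have [i2 h2] := trunc_kernel_int y e0.
have i3 : mu.-integrable setT (EFin \o (fun eta => trunc_kernel eps (y - eta) * k)).
  have := integrableZr (measurableT) k i2; by [].
have E : (fun eta => trunc_kernel eps (y - eta) * (f eta - k)) =
  (fun eta => trunc_kernel eps (y - eta) * f eta - trunc_kernel eps (y - eta) * k).
  by apply/funext => eta; rewrite mulrBr.
rewrite E; split.
  have := integrableB (measurableT) i1 i3; by [].
by rewrite RintegralB // RintegralZr // h2 mul0r subr0.
Qed.

Let meas_shell y a b p : measurable_fun setT
  (fun t : R => if a < `|y - t| <= b then `|y - t| `^ p else 0).
Proof. by meas. Qed.

Let integral_shell y (k a b p : R) : 0 <= k -> 0 < a -> a <= b -> p != 0 ->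
  (\int[mu]_eta (k * (if a < `|y - eta| <= b then `|y - eta| `^ (p - 1) else 0))%:E =
   (k * (2 * ((b `^ p - a `^ p) / p)))%:E)%E.
Proof.
move=> k0 a0 ab p0.
have m : measurable_fun setT
    (fun t : R => (k * (if a < `|t| <= b then `|t| `^ (p - 1) else 0))%:E) by meas.
rewrite (ge0_integral_reflect y m) => [|x]; last first.
  by rewrite lee_fin mulr_ge0 //; case: ifP => // _; exact: powR_ge0.
under eq_integral do rewrite EFinM.
rewrite ge0_integralZl_EFin //=; last 2 first.
- by move=> x _; rewrite lee_fin; case: ifP => // _; exact: powR_ge0.
- by meas.
by rewrite integral_powR_shell // -EFinM.
Qed.

(** Only the shell a < |t| <= b survives, and subtracting f y softens the singularity to |t|^(alpha
    - 1), whose integral is at most 2 b^alpha / alpha. With b <= 1 one has 1 + 1 / |t| <= 2 /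
    |t|. *)
Lemma sing_part_cauchy a b y : 0 < a -> a <= b -> b <= 1 ->
  `|sing_part a y - sing_part b y| <= 16 / alpha * (C0 * (A * w y)) * b `^ alpha.
Proof.
move=> a0 ab b1; have b0 := lt_le_trans a0 ab.
have K0 : 0 <= C0 * (A * w y) by nneg.
have [ia ->] := sing_partE y (f y) a0; have [ib ->] := sing_partE y (f y) b0.
rewrite -RintegralB //.
have [] := @Rintegral_bound R
  (fun eta => trunc_kernel a (y - eta) * (f eta - f y) -
              trunc_kernel b (y - eta) * (f eta - f y))
  (fun eta => 8 * (C0 * (A * w y)) *
     (if a < `|y - eta| <= b then `|y - eta| `^ (alpha - 1) else 0))
  (16 / alpha * (C0 * (A * w y)) * b `^ alpha).
- by apply: measurable_funB; apply: measurable_funM => //; meas.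
- by apply: measurable_funM => //; exact: meas_shell.
- move=> eta; rewrite -mulrBl normrM.
  move: (fB_le_at y eta) (normr_ge0 (f eta - f y)).
  move: (y - eta) `|f eta - f y| => t D hD D0.
  rewrite /trunc_kernel.
  case: (ltP a `|t|) => at_ /=; last first.
    by rewrite ifF ?subrr ?normr0 ?mul0r ?mulr0 //; apply/negbTE; rewrite -leNgt; lra.
  case: (ltP b `|t|) => bt /=; first by rewrite subrr normr0 mul0r mulr0.
  have t0 : 0 < `|t| by lra.
  have tn0 : t != 0 by rewrite -normr_gt0.
  rewrite subr0.
  apply: le_trans (ler_pM _ _ (sing_kernel_le tn0) hD) _ => //.
  have -> : `|t| `^ (alpha - 1) = `|t| `^ alpha * `|t|^-1.
    by rewrite powRB ?powRr1 ?(gt_eqF t0) ?implybT // ltW.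
  have h1 : 1 + `|t|^-1 <= 2 * `|t|^-1.
    rewrite (_ : 2 * _ = `|t|^-1 + `|t|^-1); last by ring.
    by rewrite lerD2r -[leLHS]invr1 lef_pV2 ?posrE //; lra.
  have h2 : expR (- 2 * `|t|) * expR (rho * `|t|) <= 1.
    by rewrite expRc -expR0 ler_expR mulNr oppr_le0 mulr_ge0 // ltW.
  have -> : 2 * (expR (- 2 * `|t|) * (1 + `|t|^-1)) *
    (2 * (C0 * (A * w y)) * (expR (rho * `|t|) * `|t| `^ alpha)) =
    4 * (C0 * (A * w y)) * `|t| `^ alpha *
    ((expR (- 2 * `|t|) * expR (rho * `|t|)) * (1 + `|t|^-1)) by ring.
  have -> : 8 * (C0 * (A * w y)) * (`|t| `^ alpha / `|t|) =
    4 * (C0 * (A * w y)) * `|t| `^ alpha * (1 * (2 * `|t|^-1)) by ring.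
  rewrite ler_wpM2l //; first by nneg.
  by rewrite ler_pM //; nneg.
- rewrite integral_shell //; [|by nneg|by rewrite gt_eqF].
  have -> : 16 / alpha * (C0 * (A * w y)) * b `^ alpha =
    8 * (C0 * (A * w y)) * (2 * (b `^ alpha / alpha)) by ring.
  rewrite lee_fin ler_wpM2l //; first by nneg.
  by rewrite ler_wpM2l // ler_wpM2r ?invr_ge0 ?(ltW alpha_gt0) // gerBl powR_ge0.
by [].
Qed.

(** The factor 36 multiplies the constants 18 and 2 of [trunc_kernelB_le] and [fB_le_at]; the two
    summands come from d < |t| <= 1 and from |t| > 1. *)
Definition sing_holder_cst := 36 * (8 / (1 - alpha) + 32 / c ^+ 2).

Lemma sing_part_holder d x y : 0 < d -> d <= 2^-1 -> `|x - y| <= d ->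
  `|sing_part (2 * d) x - sing_part (2 * d) y| <=
  sing_holder_cst * (C0 * (A * w y)) * d `^ alpha.
Proof.
move=> d0 d1 xy.
have dd0 : 0 < 2 * d by lra.
have K0 : 0 <= C0 * (A * w y) by nneg.
have [ix ->] := sing_partE x (f y) dd0; have [iy ->] := sing_partE y (f y) dd0.
rewrite -RintegralB //.
(* [g1] takes care of d < |t| <= 1, where (1 + 1 / |t|)^2 <= 4 / |t|^2, and [g2] of |t| > 1. *)
pose g1 eta := 36 * (C0 * (A * w y)) * d * 4 *
  (if d < `|y - eta| <= 1 then `|y - eta| `^ (alpha - 1 - 1) else 0).
pose g2 eta := 36 * (C0 * (A * w y)) * d * (8 / c) * expR (- (c / 2) * `|y - eta|).
have g1_ge0 eta : 0 <= g1 eta.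
  by rewrite /g1; case: ifP => _; nneg.
have g2_ge0 eta : 0 <= g2 eta.
  by rewrite /g2; nneg.
have mg1 : measurable_fun setT g1 by apply: measurable_funM => //; exact: meas_shell.
have mg2 : measurable_fun setT g2 by rewrite /g2; meas.
have [] := @Rintegral_bound R
  (fun eta => trunc_kernel (2 * d) (x - eta) * (f eta - f y) -
              trunc_kernel (2 * d) (y - eta) * (f eta - f y))
  (fun eta => g1 eta + g2 eta)
  (sing_holder_cst * (C0 * (A * w y)) * d `^ alpha).
- by apply: measurable_funB; apply: measurable_funM => //; meas.
- by apply: measurable_funD.
- move=> eta; rewrite -mulrBl normrM.
  have st : `|(x - eta) - (y - eta)| <= d.
    by have -> : (x - eta) - (y - eta) = x - y by ring.
  have := trunc_kernelB_le d0 d1 st.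
  move: (fB_le_at y eta) (normr_ge0 (f eta - f y)).
  move: (g1_ge0 eta) (g2_ge0 eta); rewrite /g1 /g2.
  move: (y - eta) `|f eta - f y| => t D hg1 hg2 hD D0 hT.
  move: hT hg1 hg2; case: (ltP d `|t|) => dt /= hT hg1 hg2; last first.
    apply: le_trans (ler_wpM2r _ hT) _ => //.
    by rewrite mul0r mulr0 add0r.
  have t0 : 0 < `|t| by lra.
  apply: le_trans (ler_pM _ _ hT hD) _ => //.
  have hE : 18 * (d * (expR (- 2 * `|t|) * (1 + `|t|^-1) ^+ 2)) *
    (2 * (C0 * (A * w y)) * (expR (rho * `|t|) * `|t| `^ alpha)) =
    36 * (C0 * (A * w y)) * d *
    ((expR (- c * `|t|)) * (`|t| `^ alpha * (1 + `|t|^-1) ^+ 2)).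
    by rewrite -expRc; ring.
  rewrite hE; move: hg1 hg2; case: (lerP `|t| 1) => t1 hg1 hg2.
    rewrite -[leLHS]addr0 lerD // -!mulrA !ler_wpM2l //; [by nneg..|].
    have -> : `|t| `^ (alpha - 1 - 1) = `|t| `^ alpha * `|t|^-1 ^+ 2.
      by rewrite !powRB ?powRr1 ?(gt_eqF t0) ?implybT ?ltW // expr2 mulrA.
    rewrite mulrCA [leRHS]mulrCA ler_wpM2l ?powR_ge0 //.
    have h1 : 1 + `|t|^-1 <= 2 * `|t|^-1.
      rewrite (_ : 2 * _ = `|t|^-1 + `|t|^-1); last by ring.
      by rewrite lerD2r -[leLHS]invr1 lef_pV2 ?posrE //; lra.
    have h2 : expR (- c * `|t|) <= 1.
      by rewrite -expR0 ler_expR mulNr oppr_le0 mulr_ge0 // ltW.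
    have -> : 4 * `|t|^-1 ^+ 2 = 1 * (2 * `|t|^-1) ^+ 2 by ring.
    by rewrite ler_pM ?expR_ge0 ?sqr_ge0 // lerXn2r // nnegrE; nneg.
  rewrite -[leLHS]add0r lerD // -[leRHS]mulrA ler_wpM2l //; first by nneg.
  have h3 : `|t| `^ alpha <= `|t| by rewrite ler1_powR // ltW.
  have h4 : (1 + `|t|^-1) ^+ 2 <= 4.
    have v1 : `|t|^-1 <= 1 by rewrite invf_le1 // ltW.
    have v0 : 0 <= `|t|^-1 by rewrite invr_ge0.
    by rewrite expr2; nra.
  (* Half of the remaining decay absorbs |t|^alpha <= |t|; the other half is left for the
     integration. *)
  have h5 : expR (- c * `|t|) = expR (- (c / 2) * `|t|) * expR (- (c / 2) * `|t|).
    by rewrite -expRD; congr expR; field.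
  have h6 : expR (- (c / 2) * `|t|) * `|t| <= 2 / c.
    rewrite mulNr expRN mulrC ler_pdivrMr ?expR_gt0 //.
    have := expR_ge1Dx (c / 2 * `|t|).
    move: (expR _) => E hE'.
    rewrite -[leLHS](mulKf (x := c / 2)) ?mulf_neq0 ?gt_eqF ?invr_gt0 //.
    rewrite invfM invrK (mulrC c^-1) ler_wpM2l //; first by nneg.
    lra.
  have h7 : 0 <= expR (- (c / 2) * `|t|) by exact: expR_ge0.
  rewrite h5.
  have -> : 8 / c = 2 / c * 4 by ring.
  have -> : expR (- (c / 2) * `|t|) * expR (- (c / 2) * `|t|) *
     (`|t| `^ alpha * (1 + `|t|^-1) ^+ 2) =
     (expR (- (c / 2) * `|t|) * `|t| `^ alpha) * (1 + `|t|^-1) ^+ 2 *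
      expR (- (c / 2) * `|t|) by ring.
  have h8 : 0 <= expR (- (c / 2) * `|t|) * `|t| `^ alpha by nneg.
  rewrite ler_wpM2r // ler_pM ?sqr_ge0 //.
  by apply: le_trans h6; rewrite ler_wpM2l.
- under eq_integral do rewrite EFinD.
  rewrite ge0_integralD //=; last 4 first.
  + by move=> z _; rewrite lee_fin.
  + exact/measurable_EFinP.
  + by move=> z _; rewrite lee_fin.
  + exact/measurable_EFinP.
  rewrite /g1 /g2 integral_shell //; last 3 first.
  + by nneg.
  + by lra.
  + by rewrite lt_eqF // subr_lt0.
  rewrite integral_expR_dist; last 2 first.
  + by nneg.
  + by rewrite divr_gt0.
  rewrite -EFinD lee_fin powR1.
  have da : d <= d `^ alpha by rewrite ger1_powR ?(ltW alpha_lt1) // d0; lra.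
  have da' : d `^ (alpha - 1) * d = d `^ alpha.
    by rewrite powRB ?powRr1 ?(gt_eqF d0) ?implybT ?ltW // divfK // gt_eqF.
  have a1 : 0 < 1 - alpha by rewrite subr_gt0.
  have i1 : 0 <= (1 - alpha)^-1 by rewrite invr_ge0 ltW.
  have -> : (1 - d `^ (alpha - 1)) / (alpha - 1) = (d `^ (alpha - 1) - 1) * (1 - alpha)^-1.
    by move: (d `^ _) => p; rewrite -(opprB 1 alpha) invrN mulrN -mulNr opprB.
  have ic : (2 : R) / (c / 2) = 4 / c by rewrite invfM invrK; ring.
  rewrite ic /sing_holder_cst.
  have -> : 36 * (C0 * (A * w y)) * d * 4 * (2 * ((d `^ (alpha - 1) - 1) / (1 - alpha))) +
    36 * (C0 * (A * w y)) * d * (8 / c) * (4 / c) =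
    36 * (C0 * (A * w y)) * (8 / (1 - alpha) * (d `^ (alpha - 1) * d - d) + 32 * (c^-1) ^+ 2 * d).
    by ring.
  rewrite da'.
  have -> : 36 * (8 / (1 - alpha) + 32 / c ^+ 2) * (C0 * (A * w y)) * d `^ alpha =
    36 * (C0 * (A * w y)) * (8 / (1 - alpha) * d `^ alpha + 32 * (c^-1) ^+ 2 * d `^ alpha).
    by rewrite -exprVn; ring.
  rewrite ler_wpM2l //; first by nneg.
  have i2 : 0 <= c^-1 by rewrite invr_ge0 ltW.
  apply: lerD; first by rewrite ler_wpM2l ?gerBl ?(ltW d0) // mulr_ge0.
  by rewrite ler_wpM2l // mulr_ge0 // sqr_ge0.
by [].
Qed.

Let w'_ge0 y : 0 <= w' y.
Proof. by rewrite -(pmulr_rge0 _ A_gt0) (le_trans _ (w_le y)) // ltW. Qed.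

(** * Limit of the truncations, its size and its increments *)

Lemma sing_part_limit : exists J0 : R -> R, forall y eps, 0 < eps -> eps <= 1 ->
  `|sing_part eps y - J0 y| <= 16 / alpha * (C0 * (A * w y)) * eps `^ alpha.
Proof.
have /choice[J0 hJ] : forall y, exists l, forall eps, 0 < eps -> eps <= 1 ->
    `|sing_part eps y - l| <= 16 / alpha * (C0 * (A * w y)) * eps `^ alpha.
  move=> y; apply: shrinking_bounds_limit => //; first by nneg.
  by move=> a b a0 ab b1; exact: sing_part_cauchy.
by exists J0.
Qed.

(** 8 / c bounds the truncation at radius 1 and 16 / alpha its distance to the limit. One factor A
    moves the weight to the base point, the other passes from w to w'. In the increment, 32 / alpha
    is 16 / alpha with (2 d)^alpha <= 2 d^alpha. *)
Definition op_cst_size := A ^+ 2 * (8 / c + 16 / alpha) + A.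
Definition op_cst_holder := A ^+ 2 * (sing_holder_cst + 32 / alpha + 12 / c).
Definition op_cst := 2 * op_cst_size + op_cst_holder.

Let sing_holder_cst_ge0 : 0 <= sing_holder_cst.
Proof.
rewrite /sing_holder_cst; apply: mulr_ge0 => //; apply: addr_ge0.
  by rewrite divr_ge0 // subr_ge0 ltW.
by rewrite divr_ge0 // sqr_ge0.
Qed.

Let op_cst_size_ge0 : 0 <= op_cst_size.
Proof.
rewrite /op_cst_size addr_ge0 ?(ltW A_gt0) // mulr_ge0 ?sqr_ge0 //.
by rewrite addr_ge0 // divr_ge0 // ltW.
Qed.

Let op_cst_holder_ge0 : 0 <= op_cst_holder.
Proof.
by rewrite /op_cst_holder mulr_ge0 ?sqr_ge0 // !addr_ge0 // divr_ge0 // ltW.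
Qed.

Let op_cst_size_le : op_cst_size <= op_cst.
Proof.
have s0 := op_cst_size_ge0; have h0 := op_cst_holder_ge0.
by rewrite /op_cst mulr_natl mulr2n -addrA lerDl addr_ge0.
Qed.

Section Bounds.
Variable J0 : R -> R.
Hypothesis J0_lim : forall y eps, 0 < eps -> eps <= 1 ->
  `|sing_part eps y - J0 y| <= 16 / alpha * (C0 * (A * w y)) * eps `^ alpha.

Lemma op_size y : `|J0 y + reg_part y| <= op_cst_size * C0 * w' y.
Proof.
have [_ hQ] := reg_part_int y; have [_ hP] := sing_part_int y (@ltr01 R).
have := J0_lim y (@ltr01 R) (lexx 1); rewrite powR1 mulr1 => hJ.
have -> : J0 y + reg_part y = sing_part 1 y - (sing_part 1 y - J0 y) + reg_part y by ring.
apply: le_trans (ler_normD _ _) _; apply: le_trans (lerD (ler_normB _ _) hQ) _.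
apply: le_trans (lerD (lerD hP hJ) (lexx _)) _.
rewrite invr1 /op_cst_size.
have h : C0 * (A * w y) <= A ^+ 2 * C0 * w' y.
  rewrite (_ : A ^+ 2 * C0 * w' y = C0 * (A * (A * w' y))); last by ring.
  by rewrite !ler_wpM2l // ltW.
have -> : (A ^+ 2 * (8 / c + 16 / alpha) + A) * C0 * w' y =
  (8 / c + 16 / alpha) * (A ^+ 2 * C0 * w' y) + C0 * A * w' y by ring.
rewrite lerD2r.
have -> : 4 / c * (1 + 1) * (C0 * (A * w y)) + 16 / alpha * (C0 * (A * w y)) =
  (8 / c + 16 / alpha) * (C0 * (A * w y)) by ring.
by rewrite ler_wpM2l //; nneg.
Qed.

Lemma op_holder_near x y : 0 < `|x - y| -> `|x - y| <= 2^-1 ->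
  `|(J0 x + reg_part x) - (J0 y + reg_part y)| <=
  op_cst_holder * C0 * `|x - y| `^ alpha * (w' x + w' y).
Proof.
move: (lexx `|x - y|); move: {2 3 4 5}`|x - y| => d xy d0 d1.
have hS := sing_part_holder d0 d1 xy; have hQ := reg_partB d0 d1 xy.
have dd0 : 0 < 2 * d by lra.
(* Distances are limited to 1/2 so that 2 d is an admissible radius in [J0_lim]. *)
have dd1 : 2 * d <= 1 by lra.
have hx := J0_lim x dd0 dd1; have hy := J0_lim y dd0 dd1.
have -> : (J0 x + reg_part x) - (J0 y + reg_part y) =
  (sing_part (2 * d) x - sing_part (2 * d) y) - (sing_part (2 * d) x - J0 x) +
  (sing_part (2 * d) y - J0 y) + (reg_part x - reg_part y) by ring.
apply: le_trans (ler_normD _ _) _; apply: le_trans (lerD _ hQ) _.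
  apply: le_trans (ler_normD _ _) _; apply: le_trans (lerD _ hy) _.
    by apply: le_trans (ler_normB _ _) _; apply: le_trans (lerD hS hx) _.
  exact: lexx.
have da : d <= d `^ alpha by rewrite ger1_powR ?(ltW alpha_lt1) // d0; lra.
have p0 : 0 <= d `^ alpha by exact: powR_ge0.
have d2 : (2 * d) `^ alpha <= 2 * d `^ alpha.
  rewrite powRM //; last exact: ltW.
  by rewrite ler_wpM2r // ler1_powR ?ltW // ltr1n.
have hw z : C0 * (A * w z) <= A ^+ 2 * C0 * w' z.
  rewrite (_ : A ^+ 2 * C0 * w' z = C0 * (A * (A * w' z))); last by ring.
  by rewrite !ler_wpM2l // ltW.
have Kx : 0 <= C0 * (A * w x) by nneg.
have Ky : 0 <= C0 * (A * w y) by nneg.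
have i1 : 0 <= alpha^-1 by rewrite invr_ge0 ltW.
have i2 : 0 <= c^-1 by rewrite invr_ge0 ltW.
apply: (@le_trans _ _ ((sing_holder_cst + 32 / alpha + 12 / c) * d `^ alpha *
   (C0 * (A * w x) + C0 * (A * w y)))); last first.
  have -> : op_cst_holder * C0 * d `^ alpha * (w' x + w' y) =
    (sing_holder_cst + 32 / alpha + 12 / c) * d `^ alpha *
    (A ^+ 2 * C0 * w' x + A ^+ 2 * C0 * w' y) by rewrite /op_cst_holder; ring.
  rewrite ler_wpM2l ?lerD //.
  by rewrite mulr_ge0 // !addr_ge0 // mulr_ge0.
move: (C0 * (A * w x)) (C0 * (A * w y)) Kx Ky => X Y X0 Y0.
move: sing_holder_cst sing_holder_cst_ge0 => S S0.
have e1 : S * Y * d `^ alpha <= S * d `^ alpha * (X + Y).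
  rewrite -!mulrA ler_wpM2l // (mulrC Y) ler_wpM2l //.
  by rewrite lerDr.
have e2 Z : 0 <= Z -> 16 / alpha * Z * (2 * d) `^ alpha <= 32 / alpha * d `^ alpha * Z.
  move=> Z0; have -> : 32 / alpha * d `^ alpha * Z = 16 / alpha * Z * (2 * d `^ alpha) by ring.
  by rewrite ler_wpM2l // !mulr_ge0.
have e3 : 12 / c * Y * d <= 12 / c * d `^ alpha * (X + Y).
  have h : Y <= X + Y by rewrite lerDr.
  have d0' := ltW d0.
  by rewrite -!mulrA ler_wpM2l // ler_wpM2l // (mulrC Y) ler_pM.
have := e2 _ X0; have := e2 _ Y0.
have -> : (S + 32 / alpha + 12 / c) * d `^ alpha * (X + Y) =
  S * d `^ alpha * (X + Y) + 32 / alpha * d `^ alpha * X +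
  32 / alpha * d `^ alpha * Y + 12 / c * d `^ alpha * (X + Y) by ring.
move=> e4 e5; rewrite !lerD //.
Qed.

Lemma op_holder x y :
  `|(J0 x + reg_part x) - (J0 y + reg_part y)| <=
  op_cst * C0 * `|x - y| `^ alpha * (w' x + w' y).
Proof.
have s0 := op_cst_size_ge0; have h0 := op_cst_holder_ge0.
have p0 : 0 <= `|x - y| `^ alpha by exact: powR_ge0.
have ww : 0 <= w' x + w' y by rewrite addr_ge0.
have [->|xy] := eqVneq x y.
  rewrite !subrr normr0; have c0 : 0 <= op_cst by apply: addr_ge0 => //; exact: mulr_ge0.
  apply: mulr_ge0; last exact: addr_ge0.
  by apply: mulr_ge0; [exact: mulr_ge0|exact: powR_ge0].
have n0 : 0 < `|x - y| by rewrite normr_gt0 subr_eq0.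
have [n1|n1] := lerP `|x - y| 2^-1.
  apply: le_trans (op_holder_near n0 n1) _.
  by rewrite ler_wpM2r // ler_wpM2r // ler_wpM2r // /op_cst lerDr; exact: mulr_ge0.
(* Beyond distance 1/2 the size bound suffices, since |x - y|^alpha >= (1/2)^alpha >= 1/2; this is
   the term 2 * [op_cst_size] in [op_cst]. *)
apply: le_trans (ler_normB _ _) _; apply: le_trans (lerD (op_size x) (op_size y)) _.
have half : 2^-1 <= `|x - y| `^ alpha.
  apply: (@le_trans _ _ (2^-1 `^ alpha)).
    by rewrite ger1_powR ?(ltW alpha_lt1) //; lra.
  by rewrite ge0_ler_powR ?nnegrE ?ltW //.
have -> : op_cst_size * C0 * w' x + op_cst_size * C0 * w' y =
  2 * op_cst_size * C0 * 2^-1 * (w' x + w' y) by field.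
have s2 : 0 <= 2 * op_cst_size by exact: mulr_ge0.
rewrite ler_wpM2r //; apply: ler_pM => //; first exact: mulr_ge0.
by rewrite ler_wpM2r // /op_cst lerDl.
Qed.

End Bounds.

(** * Back to the truncated principal value *)

Definition I_integrand y eta : R := half_csch (y - eta) * (f eta / (expR (- eta) + expR eta)).

Let cosh2_gt0 (y : R) : 0 < expR (- y) + expR y.
Proof. by rewrite addr_gt0 ?expR_gt0. Qed.

(** The principal value truncates the smooth kernel too, although [reg_part] integrates it over the
    whole line; [near_part] is the discrepancy. *)
Let far_part eps y eta : R := if eps < `|y - eta| then reg_kernel y eta * f eta else 0.
Let near_part eps y eta : R := if `|y - eta| <= eps then reg_kernel y eta * f eta else 0.

Let I_integrand_split (y eps eta : R) : 0 < eps ->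
  (I_integrand y \_ (H_domain y eps)) eta =
  (expR (- y) + expR y)^-1 *
  (trunc_kernel eps (y - eta) * f eta + far_part eps y eta).
Proof.
move=> e0; rewrite patchE /trunc_kernel /far_part.
have -> : (eta \in H_domain y eps) = (eps < `|y - eta|).
  by apply/idP/idP => [|h]; [rewrite inE|rewrite inE].
case: ifP => h; last by rewrite mul0r addr0 mulr0.
have ye : eta != y by rewrite eq_sym -subr_eq0 -normr_gt0 (lt_trans e0).
rewrite -mulrDl -kernel_split // /I_integrand.
by field; rewrite !gt_eqF.
Qed.

Let measurable_H_domain (y eps : R) : measurable (H_domain y eps).
Proof.
have m : measurable_fun setT (fun eta : R => eps < `|y - eta|) by meas.
have := m measurableT [set true] I.
rewrite setTI => h.
suff -> : H_domain y eps = (fun eta : R => eps < `|y - eta|) @^-1` [set true] by [].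
by apply/seteqP; split => x /=; rewrite /H_domain /=; case: (_ < _).
Qed.

Let reg_meas y : measurable_fun setT (fun eta : R => reg_kernel y eta * f eta).
Proof. by apply: measurable_funM => //; exact: measurable_reg_kernel. Qed.

Let far_part_int eps y : mu.-integrable setT (EFin \o far_part eps y).
Proof.
have [i _] := reg_part_int y.
have := le_integrable measurableT _ _ i; apply.
  have h := reg_meas y; rewrite /far_part; apply/measurable_EFinP.
  by apply: measurable_fun_ifT => //; meas.
by move=> x _; rewrite /= lee_fin /far_part; case: ifP => // _; rewrite normr0.
Qed.

(** By the triangle inequality the smooth kernel is at most 1, so an interval of length 2 eps
    contributes O(eps). *)
Lemma reg_near_le eps y : 0 < eps -> eps <= 1 ->
  mu.-integrable setT (EFin \o near_part eps y) /\
  `|\int[mu]_eta near_part eps y eta| <= 2 * (C0 * (A * w y)) * expR rho * eps.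
Proof.
move=> e0 e1.
have K0 : 0 <= C0 * (A * w y) by nneg.
apply: (@Rintegral_bound R _
  (fun eta : R => if `|y - eta| <= eps then C0 * (A * w y) * expR rho else 0)).
- by have h := reg_meas y; rewrite /near_part; apply: measurable_fun_ifT => //; meas.
- by meas.
- move=> eta; rewrite /near_part; case: ifP => h; last by rewrite normr0.
  rewrite normrM -[leRHS]mul1r ler_pM //.
    apply: le_trans (reg_kernel_le _ _) _; rewrite -expR0 ler_expR.
    have := ler_normD (y - eta) eta; rewrite subrK; lra.
  apply: le_trans (f_le_at y eta) _; rewrite ler_wpM2l // ler_expR.
  by rewrite ler_piMr //; exact: le_trans e1.
- have m : measurable_fun setT
    (fun t : R => (if `|t| <= eps then C0 * (A * w y) * expR rho else 0)%:E) by meas.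
  rewrite (ge0_integral_reflect y m) => [|x]; last first.
    by rewrite lee_fin; case: ifP => // _; nneg.
  rewrite integral_cst_ball ?(ltW e0) // lee_fin le_eqVlt; apply/orP; left; apply/eqP; ring.
Qed.

Lemma I_integrand_int y eps : 0 < eps ->
  mu.-integrable (H_domain y eps) (EFin \o I_integrand y).
Proof.
move=> e0; rewrite integrable_mkcond; last exact: measurable_H_domain.
rewrite restrict_EFin.
have -> : I_integrand y \_ (H_domain y eps) = fun eta => (expR (- y) + expR y)^-1 *
    (trunc_kernel eps (y - eta) * f eta + far_part eps y eta).
  by apply/funext => eta; exact: I_integrand_split.
have [i1 _] := sing_part_int y e0.
have := integrableZl measurableT (expR (- y) + expR y)^-1
  (integrableD measurableT i1 (far_part_int eps y)).
by [].
Qed.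

Lemma I_integrand_trunc y eps : 0 < eps -> eps <= 1 ->
  (expR (- y) + expR y) * (\int[mu]_(eta in H_domain y eps) I_integrand y eta) =
  sing_part eps y + reg_part y - \int[mu]_eta near_part eps y eta.
Proof.
move=> e0 e1; rewrite Rintegral_mkcond.
under eq_Rintegral do rewrite I_integrand_split //.
have [i1 _] := sing_part_int y e0.
have [i2 _] := reg_near_le y e0 e1.
have i3 := far_part_int eps y.
rewrite RintegralZl //; last exact: (integrableD measurableT i1 i3).
rewrite mulrA divff ?gt_eqF // mul1r RintegralD // -addrA; congr (_ + _).
have [i4 _] := reg_part_int y.
rewrite /reg_part -RintegralB //; apply: eq_Rintegral => eta _.
rewrite /far_part /near_part; case: ltP => _; by rewrite ?subr0 ?subrr.
Qed.

(** Convergence is stated with a rate, so that real and imaginary parts can be recombined by adding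
    inequalities. *)
Theorem real_operator : exists J : R -> R,
  [/\ forall y eps, 0 < eps -> mu.-integrable (H_domain y eps) (EFin \o I_integrand y),
      forall y, exists B, forall eps, 0 < eps -> eps <= 1 ->
        `|(expR (- y) + expR y) * (\int[mu]_(eta in H_domain y eps) I_integrand y eta)
          - J y| <= B * eps `^ alpha,
      forall y, `|J y| <= op_cst * C0 * w' y &
      forall x y, `|J x - J y| <= op_cst * C0 * `|x - y| `^ alpha * (w' x + w' y)].
Proof.
have [J0 hJ] := sing_part_limit.
exists (fun y => J0 y + reg_part y); split.
- exact: I_integrand_int.
- move=> y; exists (16 / alpha * (C0 * (A * w y)) + 2 * (C0 * (A * w y)) * expR rho) => eps e0 e1.
  rewrite I_integrand_trunc //; have [_ h2] := reg_near_le y e0 e1.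
  have -> : forall a b s r : R, s + r - a - (b + r) = (s - b) - a by move=> *; ring.
  apply: le_trans (ler_normB _ _) _; rewrite mulrDl lerD //; first exact: hJ.
  apply: le_trans h2 _; rewrite ler_wpM2l //; first by nneg.
  by rewrite ger1_powR ?e0 // ltW.
- move=> y; apply: le_trans (op_size hJ y) _; by rewrite !ler_wpM2r.
- exact: op_holder.
Qed.

End RealOperator.

(** * Complex-valued functions *)

Local Open Scope complex_scope.

Section ComplexOperator.
Variable R : realType.
Local Notation mu := (@lebesgue_measure R).
Local Notation normc := ComplexField.Normc.normc.

Lemma normr_Re_le (z : R[i]) : `|complex.Re z| <= normc z.
Proof.
case: z => x y /=; rewrite -sqrtr_sqr ler_wsqrtr // lerDl sqr_ge0 //.
Qed.

Lemma normr_Im_le (z : R[i]) : `|complex.Im z| <= normc z.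
Proof.
case: z => x y /=; rewrite -sqrtr_sqr ler_wsqrtr // lerDr sqr_ge0 //.
Qed.

Lemma normc_le (x y : R) : normc (x +i* y) <= `|x| + `|y|.
Proof.
rewrite /= -[leRHS]ger0_norm ?addr_ge0 // -sqrtr_sqr ler_wsqrtr //.
rewrite sqrrD !real_normK ?num_real // lerD2r lerDl mulrn_wge0 // mulr_ge0 //.
Qed.

Lemma Re_real_scale (r s : R) (z : R[i]) :
  complex.Re (r%:C * (z / s%:C)) = r * (complex.Re z / s).
Proof.
rewrite -(fmorphV (real_complex R)); case: z => x y /=.
by rewrite mulr0 mul0r !subr0.
Qed.

Lemma Im_real_scale (r s : R) (z : R[i]) :
  complex.Im (r%:C * (z / s%:C)) = r * (complex.Im z / s).
Proof.
rewrite -(fmorphV (real_complex R)); case: z => x y /=.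
by rewrite mulr0 mul0r addr0 add0r.
Qed.

Lemma cvg_complex_powR (F : R -> R[i]^o) (x y B alpha : R) : 0 < alpha ->
  (forall eps, 0 < eps -> eps <= 1 ->
    `|complex.Re (F eps) - x| + `|complex.Im (F eps) - y| <= B * eps `^ alpha) ->
  F eps @[eps --> 0^'+] --> (x +i* y : R[i]^o).
Proof.
move=> a0 hF; apply/cvgrPdist_lt => -[e e'] /=.
(* A positive complex radius is real: the order on [R[i]] forces its imaginary part to be 0. *)
rewrite ltcE /= => /andP[/eqP ->] e0.
have B0 : 0 <= B.
  have := hF 1 ltr01 (lexx _); rewrite powR1 mulr1; apply: le_trans.
  by rewrite addr_ge0.
have h : 0 < e / (B + 1) by rewrite divr_gt0 // ltr_wpDl.
have /cvgrPdist_lt /(_ _ h) hc := powR_cvg0 a0.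
near=> eps.
have e1 : 0 < eps by [].
have e2 : eps <= 1 by near: eps; exact: nbhs_right_le.
have : `|0 - eps `^ alpha| < e / (B + 1) by near: eps.
rewrite sub0r normrN ger0_norm ?powR_ge0 // ltr_pdivlMr ?ltr_wpDl // => h2.
have -> : `|(x +i* y : R[i]^o) - F eps| = (normc ((x +i* y) - F eps))%:C by [].
rewrite ltcR; apply: le_lt_trans h2.
have := hF _ e1 e2; case: (F eps) => u v /= huv.
apply: le_trans (normc_le _ _) _; rewrite (distrC x) (distrC y).
apply: le_trans huv _; rewrite mulrC ler_wpM2l ?powR_ge0 // lerDl //.
Unshelve. all: by end_near.
Qed.

(** This provides measurability, which membership in [Lambda] does not mention. Within distance 1 of
    x the moderate growth bounds w by a multiple of w x. *)
Lemma holder_continuous (alpha A rho C0 : R) (w f : R -> R) : 0 < alpha -> 0 <= C0 ->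
  (forall x, 0 < w x) -> 0 <= A ->
  (forall x y, w x <= A * expR (rho * `|y - x|) * w y) -> 0 <= rho ->
  (forall x y, `|f x - f y| <= C0 * `|x - y| `^ alpha * (w x + w y)) ->
  continuous f.
Proof.
move=> a0 C00 w0 A0 wm rho0 hf x; apply/cvgrPdist_lt => e e0.
pose K := C0 * ((A * expR rho + 1) * w x).
have K0 : 0 <= K.
  by rewrite mulr_ge0 // mulr_ge0 ?(ltW (w0 _)) // addr_ge0 // mulr_ge0 ?expR_ge0.
have h : 0 < e / (K + 1) by rewrite divr_gt0 // ltr_wpDl.
pose d := Num.min 1 ((e / (K + 1)) `^ alpha^-1).
have d0 : 0 < d by rewrite lt_min ltr01 powR_gt0.
near=> z.
have zd : `|x - z| < d by near: z; exact: cvgr_dist_lt.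
have z1 : `|x - z| <= 1 by rewrite ltW // (lt_le_trans zd) // ge_min lexx.
have zp : `|x - z| `^ alpha <= e / (K + 1).
  have -> : e / (K + 1) = ((e / (K + 1)) `^ alpha^-1) `^ alpha.
    by rewrite -powRrM mulVf ?lt0r_neq0 // powRr1 // ltW.
  rewrite ge0_ler_powR ?nnegrE ?powR_ge0 ?(ltW a0) //.
  by rewrite ltW // (lt_le_trans zd) // ge_min lexx orbT.
apply: le_lt_trans (hf x z) _.
have : w x + w z <= (A * expR rho + 1) * w x.
  rewrite mulrDl mul1r addrC lerD2r; apply: le_trans (wm z x) _.
  rewrite ler_wpM2r ?(ltW (w0 _)) // ler_wpM2l // ler_expR ler_piMr //.
move=> hw; apply: (@le_lt_trans _ _ (K * (e / (K + 1)))).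
  rewrite mulrAC ler_pM ?powR_ge0 //.
    by rewrite mulr_ge0 // addr_ge0 // ltW.
  by rewrite /K ler_wpM2l.
by rewrite mulrCA -[ltRHS]mulr1 ltr_pM2l // ltr_pdivrMr ?ltr_wpDl // mul1r ltrDl.
Unshelve. all: by end_near.
Qed.

End ComplexOperator.

Section Operator.
Variable R : realType.
Local Notation mu := (@lebesgue_measure R).
Local Notation normc := ComplexField.Normc.normc.
Variables (alpha : R) (w w' : R -> R) (A rho : R).
Hypotheses (alpha_gt0 : 0 < alpha) (alpha_lt1 : alpha < 1).
Hypotheses (rho_ge0 : 0 <= rho) (rho_lt2 : rho < 2) (A_ge1 : 1 <= A).
Hypothesis w_gt0 : forall x, 0 < w x.
Hypothesis mw : measurable_fun setT w.
Hypothesis w_moderate : forall x y, w x <= A * expR (rho * `|y - x|) * w y.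
Hypothesis w_integral : forall y,
  (\int[mu]_eta (expR (`|y| - `|y - eta| - `|eta|) * w eta)%:E <= (A * w' y)%:E)%E.
Hypothesis w_le : forall y, w y <= A * w' y.

Lemma holder_bound_ge0 (phi : R -> R[i]) C0 : holder_bound alpha w phi C0 -> 0 <= C0.
Proof.
move=> [h _]; rewrite -(pmulr_lge0 _ (w_gt0 0)) (le_trans _ (h 0)) //.
by case: (phi 0) => x y /=; rewrite sqrtr_ge0.
Qed.

(** The kernel is real, so real and imaginary parts are treated separately; the factor 2 comes from
    |z| <= |Re z| + |Im z|. *)
Lemma I_op_holder_bound (phi : R -> R[i]) C0 : holder_bound alpha w phi C0 ->
  I_defined phi /\
  holder_bound alpha w' (I_op phi) (2 * op_cst alpha A rho * C0).
Proof.
move=> hphi; have C00 := holder_bound_ge0 hphi; have [h1 h2] := hphi.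
pose u x := complex.Re (phi x); pose v x := complex.Im (phi x).
have u1 x : `|u x| <= C0 * w x by apply: le_trans (h1 x); exact: normr_Re_le.
have v1 x : `|v x| <= C0 * w x by apply: le_trans (h1 x); exact: normr_Im_le.
have u2 x y : `|u x - u y| <= C0 * `|x - y| `^ alpha * (w x + w y).
  apply: le_trans (h2 x y); apply: le_trans (normr_Re_le _).
  by rewrite /u; case: (phi x) (phi y) => [a b] [a' b'].
have v2 x y : `|v x - v y| <= C0 * `|x - y| `^ alpha * (w x + w y).
  apply: le_trans (h2 x y); apply: le_trans (normr_Im_le _).
  by rewrite /v; case: (phi x) (phi y) => [a b] [a' b'].
have A0 : 0 <= A by exact: le_trans A_ge1.
have mu_ : measurable_fun setT u.
  apply: continuous_measurable_fun.
  exact: (holder_continuous alpha_gt0 C00 w_gt0 A0 w_moderate rho_ge0 u2).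
have mv : measurable_fun setT v.
  apply: continuous_measurable_fun.
  exact: (holder_continuous alpha_gt0 C00 w_gt0 A0 w_moderate rho_ge0 v2).
have [J [J1 J2 J3 J4]] := real_operator alpha_gt0 alpha_lt1 rho_ge0 rho_lt2 A_ge1
  w_gt0 mw w_moderate w_integral w_le mu_ u1 u2.
have [L [L1 L2 L3 L4]] := real_operator alpha_gt0 alpha_lt1 rho_ge0 rho_lt2 A_ge1
  w_gt0 mw w_moderate w_integral w_le mv v1 v2.
have hRe y : (fun eta => complex.Re (H_integrand (I_density phi) y eta)) = I_integrand u y.
  by apply/funext => eta; rewrite /H_integrand /I_density Re_real_scale div1r.
have hIm y : (fun eta => complex.Im (H_integrand (I_density phi) y eta)) = I_integrand v y.
  by apply/funext => eta; rewrite /H_integrand /I_density Im_real_scale div1r.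
have k0 (y : R) : 0 < expR (- y) + expR y by rewrite addr_gt0 ?expR_gt0.
pose Z y : R[i]^o := (J y / (expR (- y) + expR y)) +i* (L y / (expR (- y) + expR y)).
have hcvg y : H_truncated (I_density phi) y eps @[eps --> 0^'+] --> Z y.
  have [B hB] := J2 y; have [B' hB'] := L2 y.
  apply: (@cvg_complex_powR _ _ _ _ ((B + B') / (expR (- y) + expR y)) alpha) => // eps e0 e1.
  rewrite /H_truncated /cintegral /= hRe hIm.
  have S (T x : R) : `|T - x / (expR (- y) + expR y)| =
    `|(expR (- y) + expR y) * T - x| / (expR (- y) + expR y).
    rewrite -[X in _ = _ / X]ger0_norm ?ltW // -normf_div; congr `|_|.
    by field; rewrite gt_eqF.
  rewrite !S -mulrDl [leRHS]mulrAC ler_wpM2r ?invr_ge0 ?(ltW (k0 y)) //.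
  by rewrite [leRHS]mulrDl lerD ?hB ?hB'.
have hI y : I_op phi y = J y +i* L y.
  rewrite /I_op /H.
  have -> : lim (H_truncated (I_density phi) y eps @[eps --> 0^'+]) = Z y.
    by apply: cvg_lim => //; exact: norm_hausdorff.
  rewrite /Z; apply/eqP; rewrite eq_complex /=.
  rewrite !mul0r subr0 addr0.
  by apply/andP; split; apply/eqP; field; rewrite gt_eqF.
split.
  move=> y; split; last by apply/cvg_ex; exists (Z y).
  move=> eps e0; rewrite /cintegrable; split.
    have := J1 y eps e0; congr (_.-integrable _ _).
    by apply/funext => eta /=; rewrite -(hRe y).
  have := L1 y eps e0; congr (_.-integrable _ _).
  by apply/funext => eta /=; rewrite -(hIm y).
split.
  move=> x; rewrite hI; apply: le_trans (normc_le _ _) _.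
  by have := J3 x; have := L3 x; lra.
move=> x y; rewrite !hI.
have -> : (J x +i* L x) - (J y +i* L y) = (J x - J y) +i* (L x - L y) by [].
apply: le_trans (normc_le _ _) _.
by have := J4 x y; have := L4 x y; lra.
Qed.

Lemma holder_bound_le (v : R -> R) (phi : R -> R[i]) K K' :
  (forall x, 0 <= v x) -> K <= K' -> holder_bound alpha v phi K ->
  holder_bound alpha v phi K'.
Proof.
move=> v0 KK [h1 h2]; split=> [x|x y].
  by apply: le_trans (h1 x) _; rewrite ler_wpM2r.
apply: le_trans (h2 x y) _.
by rewrite ler_wpM2r ?addr_ge0 // ler_wpM2r ?powR_ge0.
Qed.

Lemma I_bounded_moderate : exists C, I_bounded alpha w w' C.
Proof.
have w'0 x : 0 <= w' x.
  have A0 : 0 < A by exact: lt_le_trans A_ge1.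
  by rewrite -(pmulr_rge0 _ A0) (le_trans _ (w_le x)) // ltW.
(* Strict positivity allows division by C, so that the infimum on the right is handled one
   admissible constant at a time. *)
pose C := `|2 * op_cst alpha A rho| + 1.
have C0 : 0 < C by rewrite ltr_wpDl.
have hC phi K : holder_bound alpha w phi K -> holder_bound alpha w' (I_op phi) (C * K).
  move=> h; have [_] := I_op_holder_bound h; apply: holder_bound_le => //.
  rewrite ler_wpM2r ?(holder_bound_ge0 h) // (le_trans (ler_norm _)) // lerDl //.
exists C => phi [K hphi]; have [hd _] := I_op_holder_bound hphi.
split => //; first by exists (C * K); exact: hC.
rewrite -lee_pdivrMl //; apply: le_ereal_inf_tmp => _ [K' hK' <-].
rewrite lee_pdivrMl // -EFinM; apply: ereal_inf_lbound; exists (C * K') => //.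
exact: hC.
Qed.

End Operator.

Local Close Scope complex_scope.

(** * The weights *)

Section Weights.
Variable R : realType.
Local Notation mu := (@lebesgue_measure R).

Lemma I_bounded_weights (alpha : R) (w w' : R -> R) (A1 A2 A3 rho : R) :
  0 < alpha -> alpha < 1 -> 0 <= rho -> rho < 2 ->
  (forall x, 0 < w x) -> (forall x, 0 <= w' x) -> measurable_fun setT w ->
  (forall x y, w x <= A1 * expR (rho * `|y - x|) * w y) ->
  (forall y, (\int[mu]_eta (expR (`|y| - `|y - eta| - `|eta|) * w eta)%:E <=
    (A2 * w' y)%:E)%E) ->
  (forall y, w y <= A3 * w' y) ->
  exists C, I_bounded alpha w w' C.
Proof.
move=> a0 a1 rho0 rho2 w0 w'0 mw h1 h2 h3.
pose A := 1 + `|A1| + `|A2| + `|A3|.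
have [n1 n2 n3] : [/\ 0 <= `|A1|, 0 <= `|A2| & 0 <= `|A3|] by [].
have [l1 l2 l3] : [/\ A1 <= A, A2 <= A & A3 <= A].
  have := ler_norm A1; have := ler_norm A2; have := ler_norm A3.
  by rewrite /A; split; lra.
apply: (@I_bounded_moderate R alpha w w' A rho) => //.
- by rewrite /A; lra.
- move=> x y; apply: le_trans (h1 x y) _.
  by rewrite ler_wpM2r ?(ltW (w0 _)) // ler_wpM2r ?expR_ge0.
- by move=> y; apply: le_trans (h2 y) _; rewrite lee_fin ler_wpM2r.
- by move=> y; apply: le_trans (h3 y) _; rewrite ler_wpM2r.
Qed.

(* Opposite signs, eta between 0 and y, y between 0 and eta. *)
Lemma norm_sub_cases (y eta : R) :
  [\/ `|y - eta| = `|y| + `|eta|,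
      `|eta| <= `|y| /\ `|y - eta| = `|y| - `|eta| |
      `|y| <= `|eta| /\ `|y - eta| = `|eta| - `|y| ].
Proof.
case: (ger0P y) => hy; case: (ger0P eta) => he; case: (ger0P (y - eta)) => hd;
  first [by apply: Or31; lra | by apply: Or32; lra | by apply: Or33; lra].
Qed.

(** Between 0 and y the exponential is 1 and g takes over. Elsewhere the exponent is - 2 |eta| or -
    2 |y - eta|, and w compared with w 0 or w y leaves a decay at rate 2 - rho. *)
Lemma weight_integral (w g : R -> R) (A rho y G : R) : rho < 2 -> 0 <= A ->
  (forall x, 0 < w x) -> measurable_fun setT w ->
  (forall x y, w x <= A * expR (rho * `|y - x|) * w y) ->
  (forall eta, 0 <= g eta) -> measurable_fun setT g ->
  (forall eta, `|eta| <= `|y| -> `|y - eta| = `|y| - `|eta| -> w eta <= g eta) ->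
  (\int[mu]_eta (g eta)%:E <= G%:E)%E ->
  (\int[mu]_eta (expR (`|y| - `|y - eta| - `|eta|) * w eta)%:E <=
    (G + 2 / (2 - rho) * A * (w y + w 0))%:E)%E.
Proof.
move=> rho2 A0 w0 mw wm g0 mg wg gG.
have c0 : 0 < 2 - rho by rewrite subr_gt0.
pose k := 2 - rho.
have m1 (z : R) : measurable_fun setT (fun eta : R => A * w z * expR (- k * `|z - eta|)).
  by meas.
have p1 (z eta : R) : 0 <= A * w z * expR (- k * `|z - eta|).
  by rewrite mulr_ge0 ?expR_ge0 // mulr_ge0 // ltW.
have wz z eta : expR (- 2 * `|z - eta|) * w eta <= A * w z * expR (- k * `|z - eta|).
  have -> : A * w z * expR (- k * `|z - eta|) =
    expR (- 2 * `|z - eta|) * (A * expR (rho * `|z - eta|) * w z).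
    have -> : expR (- k * `|z - eta|) = expR (- 2 * `|z - eta|) * expR (rho * `|z - eta|).
      by rewrite -expRD /k; congr expR; ring.
    by ring.
  by rewrite ler_wpM2l ?expR_ge0.
apply: (@le_trans _ _ (\int[mu]_eta (g eta + (A * w y * expR (- k * `|y - eta|) +
   A * w 0 * expR (- k * `|0 - eta|)))%:E)%E).
  apply: ge0_le_integral => //=.
  - by move=> x _; rewrite lee_fin mulr_ge0 ?expR_ge0 // ltW.
  - by meas.
  - by meas.
  - move=> eta _; rewrite lee_fin.
    have := g0 eta; have := p1 y eta; have := p1 0 eta.
    have := wz y eta; have := wz 0 eta; rewrite sub0r normrN.
    case: (norm_sub_cases y eta) => [->|[h1 h2]|[h1 ->]].
    + have -> : `|y| - (`|y| + `|eta|) - `|eta| = - 2 * `|eta| by ring.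
      lra.
    + rewrite h2; have -> : `|y| - (`|y| - `|eta|) - `|eta| = 0 by ring.
      by rewrite expR0 mul1r; have := wg _ h1 h2; lra.
    + have -> : `|y| - (`|eta| - `|y|) - `|eta| = - 2 * (`|eta| - `|y|) by ring.
      lra.
under eq_integral do rewrite !EFinD.
rewrite ge0_integralD //=; last 4 first.
- by move=> x _; rewrite lee_fin.
- by meas.
- by move=> x _; rewrite lee_fin addr_ge0.
- by apply: emeasurable_funD; meas.
rewrite ge0_integralD //=; last 4 first.
- by move=> x _; rewrite lee_fin.
- by meas.
- by move=> x _; rewrite lee_fin.
- by meas.
rewrite !integral_expR_dist ?mulr_ge0 ?(ltW (w0 _)) // -EFinD [X in (_ <= X)%E]EFinD.
apply: leeD => //; rewrite lee_fin /k.
by rewrite le_eqVlt; apply/orP; left; apply/eqP; ring.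
Qed.

(** Each of 1 + a and 1 + b is at most the other times 1 + |a - b|; a negative exponent uses the
    inequality with a and b exchanged. *)
Lemma exprz_ratio (m : int) (a b : R) : 0 <= a -> 0 <= b ->
  (1 + a) ^ m <= (1 + b) ^ m * (1 + `|a - b|) ^+ `|m|%N.
Proof.
move=> a0 b0.
have n0 := normr_ge0 (a - b).
have ab : 1 + a <= (1 + b) * (1 + `|a - b|).
  by have := ler_norm (a - b); nra.
have ba : 1 + b <= (1 + a) * (1 + `|a - b|).
  by have := ler_norm (b - a); rewrite distrC; nra.
case: m => n /=.
  rewrite -!exprnP -exprMn lerXn2r // ?nnegrE ?mulr_ge0 ?addr_ge0 //.
rewrite NegzE -!exprnN.
rewrite -[leLHS]mul1r ler_pdivrMr ?exprn_gt0 ?ltr_pwDl //.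
rewrite mulrAC -mulrA ler_pdivlMl ?exprn_gt0 ?ltr_pwDl // mulr1.
by rewrite -exprMn lerXn2r // ?nnegrE ?mulr_ge0 ?addr_ge0.
Qed.

Lemma expr_le_expR (n : nat) (s : R) : 0 < s ->
  exists2 K, 1 <= K & forall t, 0 <= t -> (1 + t) ^+ n <= K * expR (s * t).
Proof.
(* The n-th power of 1 + t <= (1 + 1 / r) exp (r t) grows at rate n r <= s; [n.+1] keeps r defined
   for n = 0. *)
move=> s0; pose r := s / n.+1%:R.
have r0 : 0 < r by rewrite divr_gt0.
have k1 : 1 <= 1 + r^-1 by rewrite lerDl invr_ge0 ltW.
have k0 : 0 <= 1 + r^-1 by exact: le_trans k1.
exists ((1 + r^-1) ^+ n); first exact: exprn_ege1.
move=> t t0.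
apply: (@le_trans _ _ (((1 + r^-1) * expR (r * t)) ^+ n)).
  have kE : 0 <= (1 + r^-1) * expR (r * t) by rewrite mulr_ge0 ?expR_ge0.
  rewrite lerXn2r // ?nnegrE ?addr_ge0 //.
  apply: (@le_trans _ _ ((1 + r^-1) * (1 + r * t))).
    have -> : (1 + r^-1) * (1 + r * t) = 1 + t + (r^-1 + r * t) by field; rewrite gt_eqF.
    by rewrite lerDl addr_ge0 ?mulr_ge0 ?invr_ge0 // ltW.
  by rewrite ler_wpM2l ?expR_ge1Dx.
rewrite exprMn -expRM_natl ler_wpM2l ?exprn_ge0 //.
rewrite ler_expR mulrA ler_wpM2r // /r mulrCA ler_piMr ?(ltW s0) //.
by rewrite ler_pdivrMr // mul1r ler_nat.
Qed.

Lemma pow_weight_gt0 (m : int) (kappa x : R) : 0 < pow_weight m kappa x.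
Proof. by rewrite /pow_weight mulr_gt0 ?expR_gt0 // exprz_gt0 // ltr_pwDl. Qed.

Lemma measurable_pow_weight (m : int) (kappa : R) :
  measurable_fun setT (pow_weight m kappa).
Proof.
rewrite /pow_weight; apply: measurable_funM; last by meas.
have m1 : measurable_fun setT (fun x : R => 1 + `|x|) by meas.
case: m => n; first exact: (measurable_funX n m1).
exact: (measurableT_comp (@measurable_invr R) (measurable_funX n.+1 m1)).
Qed.

(** The polynomial factor costs an arbitrarily small extra rate s, so every kappa < 2 leaves room
    for rho < 2. *)
Lemma pow_weight_moderate (m : int) (kappa s : R) : 0 <= kappa -> 0 < s ->
  exists2 A, 1 <= A & forall x y,
    pow_weight m kappa x <= A * expR ((kappa + s) * `|y - x|) * pow_weight m kappa y.
Proof.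
move=> k0 s0; have [K K1 hK] := expr_le_expR `|m| s0.
exists K => // x y; rewrite /pow_weight.
have d : `|(`|x| - `|y|)| <= `|y - x| by rewrite (distrC y); exact: ler_dist_dist.
have h1 : (1 + `|x|) ^ m <= (1 + `|y|) ^ m * (K * expR (s * `|y - x|)).
  apply: le_trans (exprz_ratio m (normr_ge0 x) (normr_ge0 y)) _.
  rewrite ler_wpM2l ?exprz_ge0 ?addr_ge0 //.
  apply: le_trans (hK _ (normr_ge0 _)) _.
  by rewrite ler_wpM2l ?(le_trans ler01) // ler_expR ler_wpM2l // ltW.
have h2 : expR (kappa * `|x|) <= expR (kappa * `|y - x|) * expR (kappa * `|y|).
  rewrite -expRD ler_expR -mulrDr ler_wpM2l //.
  by have := ler_normD (x - y) y; rewrite subrK (distrC y).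
have -> : K * expR ((kappa + s) * `|y - x|) * ((1 + `|y|) ^ m * expR (kappa * `|y|)) =
  (1 + `|y|) ^ m * (K * expR (s * `|y - x|)) * (expR (kappa * `|y - x|) * expR (kappa * `|y|)).
  by rewrite mulrDl expRD; ring.
by rewrite ler_pM ?exprz_ge0 ?addr_ge0 ?expR_ge0.
Qed.

Lemma pow_weight0 (m : int) (kappa : R) : pow_weight m kappa 0 = 1.
Proof. by rewrite /pow_weight normr0 addr0 exp1rz mulr0 expR0 mulr1. Qed.

End Weights.

(** * The three kinds of weights *)

Section Cases.
Variable R : realType.
Local Notation mu := (@lebesgue_measure R).

(** For kappa > 0 the weight grows exponentially, so its integral from 0 to |y| is again of order w
    y, whatever the sign of m. *)
Lemma I_bounded_exp_weight (alpha kappa : R) (m : int) :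
  0 < alpha -> alpha < 1 -> 0 < kappa -> kappa < 2 ->
  exists C, I_bounded alpha (pow_weight m kappa) (pow_weight m kappa) C.
Proof.
move=> a0 a1 k0 k2.
have s0 : 0 < (2 - kappa) / 2 by lra.
have [K1 K11 hw] := pow_weight_moderate m (ltW k0) s0.
have k20 : 0 < kappa / 2 by lra.
have [K2 K21 hK2] := expr_le_expR `|m| k20.
have [K3 K31 hK3] := expr_le_expR `|m| k0.
have w0 := @pow_weight_gt0 R m kappa.
have mw := @measurable_pow_weight R m kappa.
set w := pow_weight m kappa in hw w0 mw *.
have rho2 : kappa + (2 - kappa) / 2 < 2 by lra.
have K10 : 0 <= K1 by exact: le_trans K11.
have K20 : 0 <= K2 by exact: le_trans K21.
(* For m < 0 the polynomial factor may be small; the exponential one makes up for it. *)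
have w0_le y : w 0 <= K3 * w y.
  rewrite /w pow_weight0 /pow_weight.
  have := exprz_ratio m (lexx 0) (normr_ge0 y).
  rewrite addr0 exp1rz sub0r normrN normr_id => h; apply: le_trans h _.
  by rewrite mulrCA ler_wpM2l ?exprz_ge0 ?addr_ge0 ?hK3.
apply: (@I_bounded_weights R alpha w w K1 (K2 * (2 / (kappa / 2)) +
  2 / (2 - (kappa + (2 - kappa) / 2)) * K1 * (1 + K3)) 1 (kappa + (2 - kappa) / 2)) => //.
- by lra.
- by move=> x; exact: ltW.
- move=> y.
  have wy0 : 0 <= K2 * w y by rewrite mulr_ge0 // ltW.
  (* Going from y towards 0, half of the rate kappa absorbs the polynomial ratio and the other half
     is integrated. *)
  apply: le_trans (@weight_integral R w (fun eta => K2 * w y * expR (- (kappa / 2) * `|y - eta|))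
    K1 (kappa + (2 - kappa) / 2) y (K2 * w y * (2 / (kappa / 2))) _ _ _ _ _ _ _ _ _) _ => //.
  + by move=> eta; rewrite mulr_ge0 ?expR_ge0.
  + by meas.
  + move=> eta h1 h2; rewrite h2 /w /pow_weight.
    have d : `|(`|eta| - `|y|)| = `|y| - `|eta| by rewrite distrC ger0_norm // subr_ge0.
    have t0 : 0 <= `|y| - `|eta| by rewrite subr_ge0.
    have := exprz_ratio m (normr_ge0 eta) (normr_ge0 y); rewrite d => h3.
    apply: le_trans (ler_wpM2r (expR_ge0 _) h3) _.
    have -> : K2 * ((1 + `|y|) ^ m * expR (kappa * `|y|)) *
        expR (- (kappa / 2) * (`|y| - `|eta|)) =
      (1 + `|y|) ^ m * (K2 * expR (kappa / 2 * (`|y| - `|eta|))) * expR (kappa * `|eta|).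
      have -> : expR (kappa * `|y|) = expR (kappa * `|eta|) *
         expR (kappa / 2 * (`|y| - `|eta|)) * expR (kappa / 2 * (`|y| - `|eta|)).
        by rewrite -!expRD; congr expR; field.
      rewrite mulNr expRN; field; by rewrite gt_eqF ?expR_gt0.
    by rewrite ler_wpM2r ?expR_ge0 // ler_wpM2l ?exprz_ge0 ?addr_ge0 ?hK2.
  + by rewrite integral_expR_dist.
  rewrite lee_fin [leRHS]mulrDl; apply: lerD.
    by rewrite le_eqVlt; apply/orP; left; apply/eqP; ring.
  rewrite -[leRHS]mulrA ler_wpM2l //; first by rewrite mulr_ge0 // divr_ge0 // subr_ge0 ltW.
  by rewrite mulrDl mul1r lerD2l.
- by move=> y; rewrite mul1r.
Qed.

(** For m >= 0 the weight increases with |x|, so between 0 and y it is at most w y; the length of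
    the interval is the power gained. *)
Lemma I_bounded_pow_weight (alpha : R) (m : int) :
  0 < alpha -> alpha < 1 -> 0 <= m ->
  exists C, I_bounded alpha (pow_weight m 0) (pow_weight (m + 1) 0) C.
Proof.
move=> a0 a1; case: m => // n _.
have [K1 K11 hw] := pow_weight_moderate (Posz n) (lexx 0) (@ltr01 R).
rewrite add0r in hw.
pose w : R -> R := pow_weight n 0; pose w' : R -> R := pow_weight (n%:Z + 1) 0.
have w0 x : 0 < w x by exact: pow_weight_gt0.
have mw : measurable_fun setT w by exact: measurable_pow_weight.
have w'0 x : 0 < w' x by exact: pow_weight_gt0.
have w'E y : w' y = (1 + `|y|) * w y.
  by rewrite /w' /w /pow_weight -PoszD addn1 -!exprnP exprS mulrA.
have K10 : 0 <= K1 by exact: le_trans K11.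
have w_mono y eta : `|eta| <= `|y| -> w eta <= w y.
  move=> h; rewrite /w /pow_weight !mul0r expR0 !mulr1 -!exprnP lerXn2r //.
  - by rewrite nnegrE addr_ge0.
  - by rewrite nnegrE addr_ge0.
  - by rewrite lerD2l.
have w_le y : w y <= w' y by rewrite w'E ler_peMl ?(ltW (w0 y)) // lerDl.
apply: (@I_bounded_weights R alpha w w' K1 (2 + 4 * K1) 1 1) => //.
- by rewrite ltr1n.
- by move=> x; exact: ltW.
- move=> y; have wy0 := ltW (w0 y).
  apply: le_trans (@weight_integral R w (fun eta => if `|eta| <= `|y| then w y else 0)
    K1 1 y (w y * (2 * `|y|)) _ _ _ _ _ _ _ _ _) _ => //.
  + by rewrite ltr1n.
  + by move=> eta; case: ifP.
  + by meas.
  + by move=> eta h _; rewrite h w_mono.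
  + by rewrite integral_cst_ball.
  rewrite lee_fin.
  have h1 : w 0 <= w y by rewrite w_mono // normr0.
  have h2 : w y * (2 * `|y|) <= 2 * w' y.
    by rewrite w'E mulrDl mul1r; have := normr_ge0 y; nra.
  have -> : 2 / (2 - 1) * K1 * (w y + w 0) = 2 * K1 * (w y + w 0).
    by congr (_ * _ * _); field; lra.
  have h3 : 2 * K1 * (w y + w 0) <= 4 * K1 * w' y.
    have := w_le y; move: (w 0) (w y) (w' y) h1 => p q r pq qr; nra.
  by rewrite [leRHS]mulrDl lerD.
- by move=> y; rewrite mul1r.
Qed.

(** The weight now decreases with |x|, so between 0 and y it is integrated exactly. The remaining
    terms are bounded constants, absorbed because the logarithmic weight is at least ln 2. *)
Lemma I_bounded_log_weight (alpha : R) : 0 < alpha -> alpha < 1 ->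
  exists C, I_bounded alpha (pow_weight (-1) 0) (log_weight 0) C.
Proof.
move=> a0 a1.
have [K1 K11 hw] := pow_weight_moderate (-1) (lexx 0) (@ltr01 R).
rewrite add0r in hw.
pose w : R -> R := pow_weight (-1) 0; pose w' : R -> R := log_weight 0.
have w0 x : 0 < w x by exact: pow_weight_gt0.
have mw : measurable_fun setT w by exact: measurable_pow_weight.
have wE y : w y = (1 + `|y|)^-1 by rewrite /w /pow_weight mul0r expR0 mulr1 exprN1.
have w'E y : w' y = ln (2 + `|y|) by rewrite /w' /log_weight mul0r expR0 mulr1.
have K10 : 0 <= K1 by exact: le_trans K11.
have l2 : 0 < ln (2 : R) by rewrite ln_gt0 // ltr1n.
have w'2 y : ln 2 <= w' y.
  by rewrite w'E ler_ln ?posrE ?lerDl // ltr_pwDl.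
have w1 y : w y <= 1 by rewrite wE invf_le1 ?lerDl // ltr_pwDl.
have w'1 y : 1 <= (ln 2)^-1 * w' y.
  by rewrite ler_pdivlMl // mulr1.
apply: (@I_bounded_weights R alpha w w' K1 (2 + 4 * K1 / ln 2) (ln 2)^-1 1) => //.
- by rewrite ltr1n.
- by move=> x; apply: le_trans (w'2 x); exact: ltW.
- move=> y; have wy0 := ltW (w0 y).
  apply: le_trans (@weight_integral R w
    (fun eta => if `|eta| <= `|y| then (1 + `|eta|)^-1 else 0)
    K1 1 y (2 * ln (1 + `|y|)) _ _ _ _ _ _ _ _ _) _ => //.
  + by rewrite ltr1n.
  + by move=> eta; case: ifP => // _; rewrite invr_ge0 addr_ge0.
  + by meas.
  + by move=> eta h _; rewrite h wE.
  + by rewrite integral_inv_ball.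
  rewrite lee_fin [leRHS]mulrDl; apply: lerD.
    by rewrite w'E ler_wpM2l // ler_ln ?posrE ?ltr_pwDl // lerD2r ler1n.
  have -> : 2 / (2 - 1) * K1 * (w y + w 0) = 2 * K1 * (w y + w 0).
    by congr (_ * _ * _); field; lra.
  have -> : 4 * K1 / ln 2 * w' y = 4 * K1 * ((ln 2)^-1 * w' y) by rewrite [RHS]mulrA.
  have := w1 y; have := w1 0; have := w'1 y.
  move: (w 0) (w y) (_^-1 * w' y) => p q r h1 h2 h3; nra.
- by move=> y; apply: le_trans (w'1 y).
Qed.

End Cases.

Theorem theorem2 (R : realType) (alpha : R)
    (alpha_gt0 : 0 < alpha) (alpha_lt1 : alpha < 1) :
  (forall (kappa : R) (m : int), 0 < kappa -> kappa < 2 ->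
     exists C : R,
       I_bounded alpha (pow_weight m kappa) (pow_weight m kappa) C) /\
  (forall m : int, 0 <= m ->
     exists C : R,
       I_bounded alpha (pow_weight m 0) (pow_weight (m + 1) 0) C) /\
  (exists C : R,
     I_bounded alpha (pow_weight (-1) 0) (log_weight 0) C).
Proof.
split; [|split].
- by move=> kappa m; exact: I_bounded_exp_weight.
- by move=> m; exact: I_bounded_pow_weight.
- exact: I_bounded_log_weight.
Qed.
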